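(* Let $e, t, k, \nu \in \mathbb{R}^+$ (here $e$ denotes an arbitrary positive real parameter and $t$ is the time variable). Also let $b, c, \gamma, \lambda, \mu \in \mathbb{C}$ with $\Re(\lambda)>0$ and $\Re(\mu)>-1$, and let $N_0$ be a constant. Then the solution $N=N(t)$ of the generalized fractional kinetic equation $$N(t) - N_{0}\,\mathcal{J}_{b,k,\mu}^{c,\gamma,\lambda}(t) = -e^{\nu}\; {}_{0}D_{t}^{-\nu} N(t)$$ is given by $$N(t) = N_{0}\sum_{n=0}^{\infty} \frac{c^{n}\,(\gamma)_{n,k}\,\Gamma(\mu+2n+1)}{(n!)^{2}\,\Gamma_{k}\left(\lambda n+\mu+\frac{b+1}{2}\right)}\left(\frac{t}{2}\right)^{\mu+2n} E_{\nu,2n+\mu+1}\left(-e^{\nu}t^{\nu}\right).$$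
   Context: $\mathbb{R}^+$ is the set of positive real numbers and $\Gamma$ is the classical Gamma function. For $k\in\mathbb{R}^+$, the $k$-Gamma function is $\Gamma_k(z)=\int_0^\infty e^{-t^k/k}\,t^{z-1}\,dt$ for $\Re(z)>0$; it satisfies $\Gamma_k(z+k)=z\,\Gamma_k(z)$ and $\Gamma_k(z)=k^{\frac{z}{k}-1}\Gamma(z/k)$, by which it is extended to other $z$ (with $1/\Gamma_k(z)=0$ at the poles). The $k$-Pochhammer symbol is $(\gamma)_{n,k}=\gamma(\gamma+k)(\gamma+2k)\cdots(\gamma+(n-1)k)$ for $n\in\mathbb{N}$, with $(\gamma)_{0,k}=1$. The generalized modified $k$-Bessel function of the first kind is defined by the series $$\mathcal{J}_{b,k,\mu}^{c,\gamma,\lambda}(z)=\sum_{n=0}^{\infty}\frac{c^{n}\,(\gamma)_{n,k}}{\Gamma_{k}\left(\lambda n+\mu+\frac{b+1}{2}\right)}\,\frac{(z/2)^{\mu+2n}}{(n!)^{2}}.$$ The Riemann-Liouville fractional integral operator is $${}_{0}D_{t}^{-\nu} f(t)=\frac{1}{\Gamma(\nu)}\int_{0}^{t}(t-u)^{\nu-1}f(u)\,du\qquad(\Re(\nu)>0).$$ The generalized (two-parameter) Mittag-Leffler function is $$E_{\alpha,\beta}(z)=\sum_{n=0}^\infty\frac{z^n}{\Gamma(\alpha n+\beta)}\qquad(z,\alpha,\beta\in\mathbb{C};\ \min\{\Re(\alpha),\Re(\beta)\}>0).$$ *)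

(* Defs.v *)
From mathcomp Require Import all_boot all_order all_algebra.
From mathcomp Require Import all_classical all_reals all_analysis.
From mathcomp Require Import complex.

Set Implicit Arguments.
Unset Strict Implicit.
Unset Printing Implicit Defensive.

Import Order.TTheory GRing.Theory Num.Theory.
Import numFieldNormedType.Exports.

Local Open Scope classical_set_scope.
Local Open Scope ring_scope.
Local Open Scope complex_scope.

Section ComplexAnalysis.
Context {R : realType}.
Implicit Types (z a : R[i]) (x : R) (u : nat -> R[i]) (D : set R)
  (f : R -> R[i]).

(* [R[i]^o] is convertible to [R[i]]; the alias is what carries the topology
   given by the complex modulus. *)
Definition csummable u : Prop := cvgn (series (u : nat -> R[i]^o)).

Definition csum u : R[i] := limn (series (u : nat -> R[i]^o)).

Definition cintegrable D f : Prop :=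
  (@lebesgue_measure R).-integrable D (fun x => (complex.Re (f x))%:E) /\
  (@lebesgue_measure R).-integrable D (fun x => (complex.Im (f x))%:E).

Definition cintegral D f : R[i] :=
  (\int[@lebesgue_measure R]_(x in D) complex.Re (f x)) +i*
  (\int[@lebesgue_measure R]_(x in D) complex.Im (f x)).

Definition cexp z : R[i] :=
  (expR (complex.Re z))%:C * (cos (complex.Im z) +i* sin (complex.Im z)).

(* Principal value of x ^ a for a real base; meaningful only for [0 < x]. *)
Definition cpow x a : R[i] := cexp (a * (ln x)%:C).

End ComplexAnalysis.

Section SpecialFunctions.
Context {R : realType}.
Implicit Types (k x t : R) (z a b c g mu nu lambda alpha beta : R[i]).

Definition kPoch k g (n : nat) : R[i] := \prod_(j < n) (g + (j%:R * k)%:C).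

(* A number m of steps of length k such that 0 < Re (z + m k). *)
Definition kshift k z : nat :=
  if 0 < complex.Re z then 0%N else (Num.truncn (- complex.Re z / k)).+1.

(* Extension of a function G given on the half-plane 0 < Re z by the
   functional equation G (z + k) = z G z.  At a pole z = - j k the divisor
   [kPoch] vanishes, so the value is 0 and, since 0^-1 = 0, the inverse of the
   extension is 0 there, which is the convention 1 / Gamma_k = 0. *)
Definition gamma_extend k (G : R[i] -> R[i]) z : R[i] :=
  G (z + ((kshift k z)%:R * k)%:C) / kPoch k z (kshift k z).

Definition kGamma k : R[i] -> R[i] :=
  gamma_extend k (fun z =>
    cintegral `]0, +oo[
      (fun t : R => (expR (- (t `^ k / k)))%:C * cpow t (z - 1))).

Definition Gamma : R[i] -> R[i] :=
  gamma_extend 1 (fun z =>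
    cintegral `]0, +oo[ (fun t : R => (expR (- t))%:C * cpow t (z - 1))).

Definition kBessel_term b k mu c g lambda x (n : nat) : R[i] :=
  c ^+ n * kPoch k g n
    / kGamma k (lambda * n%:R + mu + (b + 1) / 2%:R)
  * (cpow (x / 2%:R) (mu + (2 * n)%:R) / (n`!)%:R ^+ 2).

(* The modified k-Bessel function at a positive real argument x. *)
Definition kBessel b k mu c g lambda x : R[i] :=
  csum (kBessel_term b k mu c g lambda x).

Definition RL_integrand nu (f : R -> R[i]) t (u : R) : R[i] :=
  cpow (t - u) (nu - 1) * f u.

Definition RL_integral nu (f : R -> R[i]) t : R[i] :=
  (Gamma nu)^-1 * cintegral `]0, t[ (RL_integrand nu f t).

Definition MittagLeffler alpha beta z : R[i] :=
  csum (fun n => z ^+ n / Gamma (alpha * n%:R + beta)).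

Definition kinetic_solution_term (e k nu : R) b c g lambda mu t (n : nat) : R[i] :=
  c ^+ n * kPoch k g n * Gamma (mu + (2 * n)%:R + 1)
    / ((n`!)%:R ^+ 2 * kGamma k (lambda * n%:R + mu + (b + 1) / 2%:R))
  * cpow (t / 2%:R) (mu + (2 * n)%:R)
  * MittagLeffler nu%:C ((2 * n)%:R + mu + 1) (- (e `^ nu * t `^ nu)%:C).

End SpecialFunctions.

(* Main.v *)
Require Import Defs.
From mathcomp Require Import all_boot all_order all_algebra.
From mathcomp Require Import all_classical all_reals all_analysis.
From mathcomp Require Import complex.
From HB Require Import structures.
From mathcomp Require Import measurable_realfun ring lra.

Set Implicit Arguments.
Unset Strict Implicit.
Unset Printing Implicit Defensive.

Import Order.TTheory GRing.Theory Num.Theory.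
Import numFieldNormedType.Exports.

Local Open Scope classical_set_scope.
Local Open Scope ring_scope.
Local Open Scope complex_scope.

(** Let I be the Riemann-Liouville integral of order nu and q = - e^nu, so that
    the equation reads N = N0 * J + q * I N, with J the k-Bessel series.

    Existence. By Euler's Beta integral, I maps t^(a-1) to
    Gamma(a) / Gamma(a + nu) * t^(a+nu-1) ([cintegral_RL_power]). Hence the
    Mittag-Leffler type series
      E_a(t) = sum_m q^m Gamma(a) / Gamma(a + m nu) t^(a + m nu - 1),
    the Neumann series of the equation with forcing term t^(a-1), satisfies
    E_a - q * I E_a = t^(a-1) ([RL_ml_fun]). The Bessel series is
    J = sum_n D_n t^(mu+2n), so S = sum_n D_n E_(mu+2n+1) satisfies
    S - q * I S = J ([RL_ml_series]), and the n-th term of S is exactly that of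
    the claimed solution ([kinetic_solution_termE]).

    Both interchanges of sum and integral are cases of term-by-term integration
    under a bound A_n * h(u) with sum A_n finite and h integrable
    ([cintegral_series]). The bounds rest on two facts about Gamma functions of
    complex argument. First, |Gamma(a + n) / Gamma(a + n + s)| is at most twice
    Gamma(Re a) / Gamma(Re a + s), because the ratio is a Beta integral up to
    the factor Gamma(s) ([normc_gamma_ratio_le]). Second,
    1 / Gamma_k(lambda n + delta) grows at most geometrically in n
    ([normc_inv_kGamma_le]); with the factor (gamma)_{n,k} / (n!)^2, at most
    C^n / n! in modulus, this makes the D_n summable against every geometric
    sequence.

    The second fact needs a lower bound for |Gamma_k(x + iy)|. The mean of
    t^(iy) against the weight t^(x-1) exp(- t^k / k) has modulus at least
    1 - 2 y^2 / (k (x - k)) ([normc_kgamma_int_ge_far]), which is at least 1/2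
    once x is large; the functional equation brings this back to any x > k at
    the cost of a factor exp(- y^2 / (k (x - k))) ([normc_kgamma_int_ge]), and
    y^2 / x is linear in n along an arithmetic progression.

    Uniqueness. The difference M of two solutions satisfies M = q * I M. In the
    weighted norm int_0^T |M(t)| exp(- p t) dt, Fubini's theorem for
    convolutions ([convolution_half_line]) bounds q * I by a constant times
    int_0^oo exp(- p s) s^(nu-1) ds, which tends to 0 as p grows. Hence M
    vanishes almost everywhere, and then everywhere by the equation itself
    ([RL_homogeneous_eq0]). *)

Local Notation Re := complex.Re.
Local Notation Im := complex.Im.
Local Notation normc := Normc.normc.

(** * Real part, imaginary part and modulus *)

Section ComplexBasics.
Context {R : realType}.
Implicit Types (z w : R[i]) (r : R).

Lemma cReD z w : Re (z + w) = Re z + Re w. Proof. by case: z w => ? ? []. Qed.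
Lemma cImD z w : Im (z + w) = Im z + Im w. Proof. by case: z w => ? ? []. Qed.
Lemma cReN z : Re (- z) = - Re z. Proof. by case: z. Qed.
Lemma cImN z : Im (- z) = - Im z. Proof. by case: z. Qed.
Lemma cReM z w : Re (z * w) = Re z * Re w - Im z * Im w.
Proof. by case: z w => ? ? []. Qed.
Lemma cImM z w : Im (z * w) = Re z * Im w + Im z * Re w.
Proof. by case: z w => ? ? []. Qed.
Lemma cReMr r z : Re (r%:C * z) = r * Re z.
Proof. by rewrite cReM /= mul0r subr0. Qed.
Lemma cImMr r z : Im (r%:C * z) = r * Im z.
Proof. by rewrite cImM /= mul0r addr0. Qed.
Lemma cReB z w : Re (z - w) = Re z - Re w. Proof. by rewrite cReD cReN. Qed.
Lemma cImB z w : Im (z - w) = Im z - Im w. Proof. by rewrite cImD cImN. Qed.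
Lemma cRe_nat n : Re (n%:R : R[i]) = n%:R.
Proof. by rewrite -(rmorph_nat (real_complex R)). Qed.
Lemma cIm_nat n : Im (n%:R : R[i]) = 0.
Proof. by rewrite -(rmorph_nat (real_complex R)). Qed.

Lemma complexP z w : Re z = Re w -> Im z = Im w -> z = w.
Proof. by case: z w => ? ? [? ?] /= -> ->. Qed.

Lemma normc_ge0 z : 0 <= normc z.
Proof. by case: z => a b /=; rewrite sqrtr_ge0. Qed.

Lemma sqr_normcE z : normc z ^+ 2 = Re z ^+ 2 + Im z ^+ 2.
Proof. by case: z => a b /=; rewrite sqr_sqrtr// addr_ge0 ?sqr_ge0. Qed.

Lemma le_Re_normc z : `|Re z| <= normc z.
Proof.
rewrite -(@ler_pXn2r _ 2) ?nnegrE ?normc_ge0// sqr_normcE real_normK ?num_real//.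
by rewrite lerDl sqr_ge0.
Qed.

Lemma le_Im_normc z : `|Im z| <= normc z.
Proof.
rewrite -(@ler_pXn2r _ 2) ?nnegrE ?normc_ge0// sqr_normcE real_normK ?num_real//.
by rewrite lerDr sqr_ge0.
Qed.

Lemma normc_le z : normc z <= `|Re z| + `|Im z|.
Proof.
rewrite -(@ler_pXn2r _ 2) ?nnegrE ?normc_ge0 ?addr_ge0// sqr_normcE sqrrD.
rewrite !real_normK ?num_real//.
by rewrite addrAC lerDl mulrn_wge0// mulr_ge0.
Qed.

Lemma normcR r : normc r%:C = `|r|.
Proof. by rewrite /= expr0n addr0 sqrtr_sqr. Qed.

Lemma normc_nat n : normc (n%:R : R[i]) = n%:R.
Proof. by rewrite -(rmorph_nat (real_complex R)) normcR ger0_norm. Qed.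

Lemma normcX z n : normc (z ^+ n) = normc z ^+ n.
Proof.
elim: n => [|n IHn]; first by rewrite !expr0 Normc.normc1.
by rewrite !exprS Normc.normcM IHn.
Qed.

Lemma normc_eq0 z : (normc z == 0) = (z == 0).
Proof.
apply/eqP/eqP => [/Normc.eq0_normc//|->]; exact: Normc.normc0.
Qed.

Lemma normc_gt0 z : (0 < normc z) = (z != 0).
Proof. by rewrite lt_def normc_ge0 andbT normc_eq0. Qed.

End ComplexBasics.

(** * Complex series *)

Section ComplexSeries.
Context {R : realType}.
Implicit Types (u v : nat -> R[i]) (l : R[i]).

(** The complex series with general term [u] converges to [l]; the definition is
    componentwise, [has_csum_cvg] gives convergence for the modulus. *)
Definition has_csum u l : Prop :=
  series (fun n => Re (u n)) @ \oo --> Re l /\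
  series (fun n => Im (u n)) @ \oo --> Im l.

Lemma cvg_complex (s : nat -> R[i]) l :
  (fun n => Re (s n)) @ \oo --> Re l -> (fun n => Im (s n)) @ \oo --> Im l ->
  (s : nat -> R[i]^o) @ \oo --> (l : R[i]^o).
Proof.
move=> /cvgrPdist_lt cr /cvgrPdist_lt ci; apply/cvgrPdist_lt => /= e e0.
have er : Im e = 0 by apply: ger0_Im; exact: ltW.
have e'0 : 0 < Re e by move: e0; rewrite ltcE => /andP[].
have e2 : 0 < Re e / 2 by rewrite divr_gt0.
near=> n.
rewrite ltcE /= er eqxx /=.
change (normc (l - s n) < Re e).
apply: le_lt_trans (normc_le _) _.
rewrite cReB cImB (splitr (Re e)) ltrD//.
- by near: n; exact: cr.
- by near: n; exact: ci.
Unshelve. all: by end_near. Qed.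

Lemma Re_series u n : Re (series u n) = series (fun n => Re (u n)) n.
Proof.
rewrite /series /=; elim: n => [|n IHn]; first by rewrite !big_nil.
by rewrite !big_nat_recr//= cReD IHn.
Qed.

Lemma Im_series u n : Im (series u n) = series (fun n => Im (u n)) n.
Proof.
rewrite /series /=; elim: n => [|n IHn]; first by rewrite !big_nil.
by rewrite !big_nat_recr//= cImD IHn.
Qed.

Lemma has_csum_cvg u l : has_csum u l ->
  series (u : nat -> R[i]^o) @ \oo --> (l : R[i]^o).
Proof.
move=> [cr ci]; apply: cvg_complex.
- by under eq_fun do rewrite Re_series.
- by under eq_fun do rewrite Im_series.
Qed.

Lemma has_csum_summable u l : has_csum u l -> csummable u.
Proof. by move=> /has_csum_cvg ul; apply/cvg_ex; exists l. Qed.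

Lemma has_csum_csum u l : has_csum u l -> csum u = l.
Proof. by move=> /has_csum_cvg; exact: cvg_lim. Qed.

Lemma has_csum_uniq u l l' : has_csum u l -> has_csum u l' -> l = l'.
Proof. by move=> /has_csum_csum <- /has_csum_csum <-. Qed.

Lemma cvg_seriesD (a b : R^nat) x y :
  series a @ \oo --> x -> series b @ \oo --> y ->
  series (fun n => a n + b n) @ \oo --> x + y.
Proof. by move=> ax bx; rewrite (seriesD a b); exact: cvgD. Qed.

Lemma cvg_seriesZ (a : R^nat) r x :
  series a @ \oo --> x -> series (fun n => r * a n) @ \oo --> r * x.
Proof.
move=> ax; rewrite (_ : series _ = fun n => r * series a n).
  by apply: cvgM => //; exact: cvg_cst.
by apply/funext => n; rewrite /series /= mulr_sumr.
Qed.

Lemma cvg_seriesS (a : R^nat) x :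
  series a @ \oo --> x -> series (fun n => a n.+1) @ \oo --> x - a 0%N.
Proof.
move=> ax.
have -> : series (fun n => a n.+1) = (fun n => series a n.+1 - a 0%N).
  apply/funext => n; rewrite /series /= big_nat_recl//= addrAC subrr add0r.
  by [].
by apply: cvgB; [rewrite -(cvg_shiftS (series a)) in ax|exact: cvg_cst].
Qed.

Lemma has_csumD u v x y : has_csum u x -> has_csum v y ->
  has_csum (fun n => u n + v n) (x + y).
Proof.
move=> [ur ui] [vr vi]; split; rewrite ?cReD ?cImD.
- by under eq_fun do rewrite cReD; exact: cvg_seriesD.
- by under eq_fun do rewrite cImD; exact: cvg_seriesD.
Qed.

Lemma has_csumZ u x z : has_csum u x -> has_csum (fun n => z * u n) (z * x).
Proof.
move=> [ur ui]; split; rewrite ?cReM ?cImM.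
- under eq_fun do rewrite cReM -mulNr; rewrite -mulNr.
  by apply: cvg_seriesD; exact: cvg_seriesZ.
- under eq_fun do rewrite cImM.
  by apply: cvg_seriesD; exact: cvg_seriesZ.
Qed.

(** Removal of the first term. *)
Lemma has_csumS u x : has_csum u x -> has_csum (fun n => u n.+1) (x - u 0%N).
Proof.
move=> [ur ui]; split; rewrite ?cReB ?cImB.
- exact: (cvg_seriesS ur).
- exact: (cvg_seriesS ui).
Qed.

Lemma cvg_series_le (a : R^nat) (A : R^nat) : (forall n, `|a n| <= A n) ->
  cvgn (series A) -> cvgn (series a) /\ `|limn (series a)| <= limn (series A).
Proof.
move=> aA cA.
have c : cvgn [normed series a].
  by apply: (series_le_cvg _ _ aA cA) => n //; exact: le_trans (aA n).
split; first exact: normed_cvg.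
apply: (le_trans (lim_series_norm c)).
by apply: lim_series_le.
Qed.

(** Absolutely convergent complex series converge, the sum being controlled by
    that of the majorant. *)
Lemma has_csum_le u (A : R^nat) : (forall n, normc (u n) <= A n) ->
  cvgn (series A) ->
  exists2 l, has_csum u l & normc l <= 2 * limn (series A).
Proof.
move=> uA cA.
have [cr lr] := cvg_series_le (fun n => le_trans (le_Re_normc (u n)) (uA n)) cA.
have [ci li] := cvg_series_le (fun n => le_trans (le_Im_normc (u n)) (uA n)) cA.
exists (limn (series (fun n => Re (u n))) +i* limn (series (fun n => Im (u n)))).
  by split.
apply: le_trans (normc_le _) _.
by rewrite mulr_natl mulr2n lerD.
Qed.

End ComplexSeries.

(** * Integrals of complex-valued functions *)

Section ComplexIntegral.
Context {R : realType}.
Notation mu := (@lebesgue_measure R).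
Implicit Types (D : set R) (f g : R -> R[i]).

(** Measurability of both components. *)
Definition cmeasurable D f : Prop :=
  measurable_fun D (fun x => Re (f x)) /\ measurable_fun D (fun x => Im (f x)).

Lemma cintegrable_cmeasurable D f : measurable D ->
  cintegrable D f -> cmeasurable D f.
Proof.
by move=> mD [/integrableP[mr _] /integrableP[mi _]]; split; apply/measurable_EFinP.
Qed.

Lemma cmeasurableM D f g : cmeasurable D f -> cmeasurable D g ->
  cmeasurable D (fun x => f x * g x).
Proof.
move=> [fr fi] [gr gi]; split.
- by under eq_fun do rewrite cReM; apply: measurable_funB; exact: measurable_funM.
- by under eq_fun do rewrite cImM; apply: measurable_funD; exact: measurable_funM.
Qed.

Lemma cmeasurable_real D (h : R -> R) :
  measurable_fun D h -> cmeasurable D (fun x => (h x)%:C).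
Proof. by move=> mh; split => //=; exact: measurable_cst. Qed.

Lemma le_cintegrable D f (h : R -> R) : measurable D -> cmeasurable D f ->
  (forall x, D x -> normc (f x) <= h x) -> mu.-integrable D (EFin \o h) ->
  cintegrable D f.
Proof.
move=> mD [mr mi] fh ih; split.
- apply: (le_integrable (mu:=mu) mD _ _ ih); first exact/measurable_EFinP.
  move=> x Dx /=; rewrite lee_fin (le_trans (le_Re_normc _))//.
  by rewrite (le_trans (fh _ Dx))// ler_norm.
- apply: (le_integrable (mu:=mu) mD _ _ ih); first exact/measurable_EFinP.
  move=> x Dx /=; rewrite lee_fin (le_trans (le_Im_normc _))//.
  by rewrite (le_trans (fh _ Dx))// ler_norm.
Qed.

Lemma integrable_scale D (h : R -> R) r : measurable D ->
  mu.-integrable D (EFin \o h) -> mu.-integrable D (EFin \o (fun x => r * h x)).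
Proof. by move=> mD ih; exact: (integrableZl (mu:=mu) mD r ih). Qed.

Lemma cintegrableZ D f z : measurable D -> cintegrable D f ->
  cintegrable D (fun x => z * f x).
Proof.
move=> mD [fr fi].
split.
- under eq_fun do rewrite cReM EFinB !EFinM.
  by apply: (integrableB (mu:=mu) mD); exact: integrableZl.
- under eq_fun do rewrite cImM EFinD !EFinM.
  by apply: (integrableD (mu:=mu) mD); exact: integrableZl.
Qed.

Lemma cintegralZ D f z : measurable D -> cintegrable D f ->
  cintegral D (fun x => z * f x) = z * cintegral D f.
Proof.
move=> mD [fr fi].
apply: complexP; rewrite /= ?cReM ?cImM /=.
- under eq_Rintegral do rewrite cReM.
  rewrite RintegralB//; [|exact: integrable_scale..].
  by rewrite !RintegralZl.
- under eq_Rintegral do rewrite cImM.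
  rewrite RintegralD//; [|exact: integrable_scale..].
  by rewrite !RintegralZl.
Qed.

Lemma cintegrableD D f g : measurable D -> cintegrable D f -> cintegrable D g ->
  cintegrable D (fun x => f x + g x).
Proof.
move=> mD [fr fi] [gr gi]; split.
- by under eq_fun do rewrite cReD EFinD; exact: integrableD.
- by under eq_fun do rewrite cImD EFinD; exact: integrableD.
Qed.

Lemma cintegralD D f g : measurable D -> cintegrable D f -> cintegrable D g ->
  cintegral D (fun x => f x + g x) = cintegral D f + cintegral D g.
Proof.
move=> mD [fr fi] [gr gi]; apply: complexP; rewrite /=.
- by under eq_Rintegral do rewrite cReD; exact: RintegralD.
- by under eq_Rintegral do rewrite cImD; exact: RintegralD.
Qed.

Lemma eq_cintegrable D f g : measurable D -> (forall x, D x -> f x = g x) ->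
  cintegrable D f -> cintegrable D g.
Proof.
move=> mD fg [fr fi]; split.
- by apply: (eq_integrable (mu:=mu) mD _ _ _ fr) => x /set_mem Dx; rewrite fg.
- by apply: (eq_integrable (mu:=mu) mD _ _ _ fi) => x /set_mem Dx; rewrite fg.
Qed.

Lemma eq_cintegral D f g : (forall x, D x -> f x = g x) ->
  cintegral D f = cintegral D g.
Proof.
move=> fg; rewrite /cintegral; congr (_ +i* _).
- by apply: eq_Rintegral => x /set_mem Dx; rewrite fg.
- by apply: eq_Rintegral => x /set_mem Dx; rewrite fg.
Qed.

(** The factor 2 comes from bounding the real and imaginary parts separately. *)
Lemma normc_cintegral_le D f (h : R -> R) : measurable D -> cmeasurable D f ->
  (forall x, D x -> normc (f x) <= h x) -> mu.-integrable D (EFin \o h) ->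
  normc (cintegral D f) <= 2 * \int[mu]_(x in D) h x.
Proof.
move=> mD mf fh ih.
have [fr fi] := le_cintegrable mD mf fh ih.
apply: le_trans (normc_le _) _.
rewrite mulr_natl mulr2n /=; apply: lerD.
- apply: (le_trans (le_normr_Rintegral (mu:=mu) mD fr)).
  apply: le_Rintegral => //; first exact: (integrable_norm fr).
  by move=> x Dx; apply: le_trans (fh x Dx); exact: le_Re_normc.
- apply: (le_trans (le_normr_Rintegral (mu:=mu) mD fi)).
  apply: le_Rintegral => //; first exact: (integrable_norm fi).
  by move=> x Dx; apply: le_trans (fh x Dx); exact: le_Im_normc.
Qed.

(** The real case of [cintegral_series]: dominated convergence of the partial
    sums, with dominating function [limn (series A) * h]. *)
Lemma integral_series_real D (f_ : nat -> R -> R) (f h : R -> R) (A : R^nat) :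
  measurable D -> (forall n, measurable_fun D (f_ n)) ->
  (forall n x, D x -> `|f_ n x| <= A n * h x) ->
  mu.-integrable D (EFin \o h) -> (forall n, 0 <= A n) ->
  (forall x, D x -> 0 <= h x) -> cvgn (series A) ->
  (forall x, D x -> series (f_ ^~ x) @ \oo --> f x) ->
  mu.-integrable D (EFin \o f) /\
  series (fun n => \int[mu]_(x in D) f_ n x) @ \oo --> \int[mu]_(x in D) f x.
Proof.
move=> mD mf fA ih A0 h0 cA ff.
have ifn n : mu.-integrable D (EFin \o f_ n).
  apply: (le_integrable (mu:=mu) mD _ _ (integrable_scale (A n) mD ih)).
    by apply/measurable_EFinP; exact: mf.
  move=> x Dx; rewrite /= lee_fin (le_trans (fA _ _ Dx))// ler_norm//.
pose S := limn (series A).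
have serE n : \int[mu]_(x in D) series (f_ ^~ x) n =
    series (fun n => \int[mu]_(x in D) f_ n x) n /\
    mu.-integrable D (EFin \o (fun x => series (f_ ^~ x) n)).
  rewrite /series /=; elim: n => [|n [IHn IHi]].
    split; first by under eq_Rintegral do rewrite big_nil; rewrite Rintegral_cst// mul0r big_nil.
    rewrite (_ : _ \o _ = cst 0)%E; first exact: integrable0.
    by apply/funext => x /=; rewrite big_nil.
  split.
    under eq_Rintegral do rewrite big_nat_recr//=.
    by rewrite RintegralD// IHn big_nat_recr.
  apply: (eq_integrable (mu:=mu) mD _ _ _
    (integrableD (mu:=mu) mD IHi (ifn n))) => x _ /=.
  by rewrite big_nat_recr.
have ig := integrable_scale S mD ih.
have Sle n : series A n <= S.
  apply: nondecreasing_cvgn_le => //.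
  by apply: nondecreasing_series.
have dom : forall n x, D x -> (`| ((series (f_ ^~ x) n)%:E) | <= (S * h x)%:E)%E.
  move=> n x Dx; rewrite /= lee_fin.
  apply: (le_trans (ler_norm_sum _ _ _)).
  apply: (le_trans (ler_sum _ (fun i _ => fA i x Dx))).
  by rewrite -mulr_suml ler_wpM2r ?h0// Sle.
have mser n : measurable_fun D (fun x => (series (f_ ^~ x) n)%:E).
  by have [_ /integrableP[]] := serE n.
have cv x : D x -> (fun n => (series (f_ ^~ x) n)%:E) @ \oo --> (f x)%:E.
  by move=> Dx; apply: cvg_EFin; [exact: nearW|exact: ff].
have mfl : measurable_fun D (EFin \o f).
  exact: (emeasurable_fun_cvg _ _ mser cv).
have [if_ _ cvi] := dominated_convergence (mu:=mu) mD mser mfl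
  (aeW mu cv) ig (aeW mu (fun x n Dx => dom n x Dx)).
split => //.
have fin : (\int[mu]_(x in D) (f x)%:E \is a fin_num)%E by exact: integrable_fin_num.
rewrite /Rintegral.
have -> : series (fun n => fine (\int[mu]_(x in D) (f_ n x)%:E)) =
  fine \o (fun n => \int[mu]_(x in D) (series (f_ ^~ x) n)%:E)%E.
  by apply/funext => n /=; rewrite -(serE n).1.
apply: fine_cvg; rewrite fineK//.
Qed.

(** Term-by-term integration of a complex series of functions dominated by
    [A n * h] with [A] summable and [h] integrable. *)
Lemma cintegral_series D (f_ : nat -> R -> R[i]) (f : R -> R[i]) (h : R -> R)
    (A : R^nat) :
  measurable D -> (forall n, cmeasurable D (f_ n)) ->
  (forall n x, D x -> normc (f_ n x) <= A n * h x) ->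
  mu.-integrable D (EFin \o h) -> (forall n, 0 <= A n) ->
  (forall x, D x -> 0 <= h x) -> cvgn (series A) ->
  (forall x, D x -> has_csum (f_ ^~ x) (f x)) ->
  cintegrable D f /\ has_csum (fun n => cintegral D (f_ n)) (cintegral D f).
Proof.
move=> mD mf fA ih A0 h0 cA ff.
have [ir cr] := integral_series_real mD (fun n => (mf n).1)
  (fun n x Dx => le_trans (le_Re_normc _) (fA n x Dx)) ih A0 h0 cA
  (fun x Dx => (ff x Dx).1).
have [ii ci] := integral_series_real mD (fun n => (mf n).2)
  (fun n x Dx => le_trans (le_Im_normc _) (fA n x Dx)) ih A0 h0 cA
  (fun x Dx => (ff x Dx).2).
by [].
Qed.

End ComplexIntegral.

(** * Complex powers of positive reals *)

Section ComplexPowers.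
Context {R : realType}.
Implicit Types (x y t : R) (a b z : R[i]).

Lemma Re_cpow x a : Re (cpow x a) = expR (Re a * ln x) * cos (Im a * ln x).
Proof. by case: a => p q; rewrite /cpow /cexp /= !mulr0 subr0 add0r mul0r subr0. Qed.

Lemma Im_cpow x a : Im (cpow x a) = expR (Re a * ln x) * sin (Im a * ln x).
Proof. by case: a => p q; rewrite /cpow /cexp /= !mulr0 subr0 add0r mul0r addr0. Qed.

Lemma cpowD x a b : cpow x (a + b) = cpow x a * cpow x b.
Proof.
by apply: complexP; rewrite [RHS](cReM, cImM) !(Re_cpow, Im_cpow) cReD cImD !mulrDl expRD
  ?cosD ?sinD; ring.
Qed.

Lemma normc_cpow x a : 0 < x -> normc (cpow x a) = x `^ Re a.
Proof.
move=> x0; rewrite -[LHS]ger0_norm ?normc_ge0// -sqrtr_sqr sqr_normcE.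
rewrite Re_cpow Im_cpow !exprMn -mulrDr cos2Dsin2 mulr1 sqrtr_sqr.
by rewrite ger0_norm ?expR_ge0// /powR gt_eqF.
Qed.

Lemma cpow_real x r : 0 < x -> cpow x r%:C = (x `^ r)%:C.
Proof.
move=> x0; apply: complexP; rewrite ?Re_cpow ?Im_cpow /= mul0r.
- by rewrite cos0 mulr1 /powR gt_eqF.
- by rewrite sin0 mulr0.
Qed.

Lemma cpowM x y a : 0 < x -> 0 < y -> cpow (x * y) a = cpow x a * cpow y a.
Proof.
move=> x0 y0.
by apply: complexP; rewrite [RHS](cReM, cImM) !(Re_cpow, Im_cpow) lnM ?posrE// !mulrDr expRD
  ?cosD ?sinD; ring.
Qed.

Lemma cpow_neq0 x a : 0 < x -> cpow x a != 0.
Proof. by move=> x0; rewrite -normc_gt0 normc_cpow// powR_gt0. Qed.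

Lemma cmeasurable_cpow (D : set R) a : measurable D -> cmeasurable D (cpow ^~ a).
Proof.
move=> mD; split; apply: (measurable_funS measurableT) => //.
- under eq_fun do rewrite Re_cpow; apply: measurable_funM.
    by apply: measurableT_comp => //; exact: measurable_funM.
  apply: measurableT_comp; last exact: measurable_funM.
  by apply: continuous_measurable_fun; exact: continuous_cos.
- under eq_fun do rewrite Im_cpow; apply: measurable_funM.
    by apply: measurableT_comp => //; exact: measurable_funM.
  apply: measurableT_comp; last exact: measurable_funM.
  by apply: continuous_measurable_fun; exact: continuous_sin.
Qed.

End ComplexPowers.

(** * Integrals of derivatives on the half-line *)

Section HalfLineIntegrals.
Context {R : realType}.
Notation mu := (@lebesgue_measure R).
Implicit Types (f F : R -> R).

Lemma pos_itvP (x : R) : (`]0, +oo[%classic : set R) x -> 0 < x.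
Proof. by rewrite /= in_itv/= andbT. Qed.

(** The compact intervals exhausting the positive half-line. *)
Definition exhaust_itv (n : nat) : set R := `[n.+1%:R^-1, n.+1%:R]%classic.

Lemma bigcup_exhaust_itv : \bigcup_n exhaust_itv n = `]0, +oo[%classic.
Proof.
apply/seteqP; split => x /=.
  move=> [n _]; rewrite /exhaust_itv /= !in_itv/= andbT => /andP[+ _].
  by apply: lt_le_trans; rewrite invr_gt0.
rewrite in_itv/= andbT => x0.
pose m := Num.truncn (Num.max x x^-1).
have hm : Num.max x x^-1 < m.+1%:R by rewrite truncnS_gt.
exists m => //; rewrite /exhaust_itv /= in_itv/=; apply/andP; split.
- rewrite -[leRHS]invrK lef_pV2 ?posrE ?invr_gt0//.
  by rewrite ltW// (le_lt_trans _ hm)// le_max lexx orbT.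
- by rewrite ltW// (le_lt_trans _ hm)// le_max lexx.
Qed.

Lemma exhaust_itv_sub n : exhaust_itv n `<=` `]0, +oo[%classic.
Proof. by rewrite -bigcup_exhaust_itv; exact: bigcup_sup. Qed.

Lemma exhaust_itv_nd : nondecreasing_seq exhaust_itv.
Proof.
apply/nondecreasing_seqP => n; apply/subsetPset => x; rewrite /exhaust_itv /= !in_itv/=.
move=> /andP[h1 h2]; apply/andP; split.
- by apply: le_trans h1; rewrite lef_pV2 ?posrE// ler_nat.
- by apply: (le_trans h2); rewrite ler_nat.
Qed.

Lemma measurable_exhaust_itv n : measurable (exhaust_itv n).
Proof. exact: measurable_itv. Qed.

Lemma continuous_pos_measurable f :
  (forall x : R, 0 < x -> {for x, continuous f}) -> measurable_fun (`]0, +oo[%classic : set R) f.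
Proof.
move=> cf; apply: open_continuous_measurable_fun; first exact: interval_open.
by move=> x; rewrite inE/= in_itv/= andbT; exact: cf.
Qed.

(** The fundamental theorem of calculus on a compact interval of the positive
    half-line, for a function differentiable there. *)
Lemma FTC_pos f F (a b : R) : 0 < a -> a < b ->
  (forall x : R, 0 < x -> {for x, continuous f}) ->
  (forall x : R, 0 < x -> is_derive x 1 F (f x)) ->
  (\int[mu]_(x in `[a, b]) (f x)%:E = (F b - F a)%:E)%E.
Proof.
move=> a0 ab cf dF.
have b0 := lt_trans a0 ab.
have cF (x : R) : 0 < x -> {for x, continuous F}.
  move=> x0; apply/differentiable_continuous/derivable1_diffP.
  by have [] := dF _ x0.
rewrite (@continuous_FTC2 _ f F) ?EFinB//.
- apply: continuous_in_subspaceT => x; rewrite inE/= in_itv/= => /andP[ax _].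
  by apply: cf; exact: lt_le_trans ax.
- split.
  + move=> x; rewrite in_itv/= => /andP[ax _].
    by have [] := dF _ (lt_trans a0 ax).
  + by apply: cvg_at_right_filter; exact: cF.
  + by apply: cvg_at_left_filter; exact: cF.
- move=> x; rewrite in_itv/= => /andP[ax _].
  by rewrite derive1E; have [] := dF _ (lt_trans a0 ax).
Qed.

Lemma cvg_bounded_le (u : (\bar R)^nat) (l : \bar R) (M : \bar R) :
  u @ \oo --> l -> (forall n, u n <= M)%E -> (l <= M)%E.
Proof.
move=> ul uM; rewrite -(cvg_lim _ ul)//.
by apply: lime_le; [apply/cvg_ex; exists l|exact: nearW].
Qed.

(** A nonnegative function with a bounded antiderivative is integrable on the
    half-line. *)
Lemma integrable_bounded_antiderivative f F (M : R) :
  (forall x : R, 0 < x -> 0 <= f x) ->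
  (forall x : R, 0 < x -> {for x, continuous f}) ->
  (forall x : R, 0 < x -> is_derive x 1 F (f x)) ->
  (forall x : R, 0 < x -> `|F x| <= M) ->
  mu.-integrable `]0, +oo[ (EFin \o f).
Proof.
move=> f0 cf dF FM.
have mf := continuous_pos_measurable cf.
apply/integrableP; split; first exact/measurable_EFinP.
have -> : (\int[mu]_(x in `]0%R, +oo[) `|(EFin \o f) x| =
           \int[mu]_(x in `]0%R, +oo[) (f x)%:E)%E.
  apply: eq_integral => x; rewrite inE/= in_itv/= andbT => x0.
  by rewrite ger0_norm// f0.
apply: (@le_lt_trans _ _ (M + M)%:E); last exact: ltry.
rewrite -bigcup_exhaust_itv.
apply: (@cvg_bounded_le (fun n => \int[mu]_(x in exhaust_itv n) (f x)%:E)%E).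
  apply: ge0_nondecreasing_set_cvg_integral.
  - exact: exhaust_itv_nd.
  - by move=> n; exact: measurable_exhaust_itv.
  - move=> n; apply/measurable_EFinP; apply: measurable_funS mf => //.
    exact: exhaust_itv_sub.
  - move=> n x /exhaust_itv_sub; rewrite /= in_itv/= andbT => x0.
    by rewrite lee_fin f0.
move=> n; rewrite /exhaust_itv.
have n0 : 0 < n.+1%:R :> R by [].
have := f0; case: n n0 => [|n] n0 _.
  by rewrite invr1 set_itv1 integral_set1 lee_fin addr_ge0//;
    apply: le_trans (FM 1 _).
have i0 : 0 < n.+2%:R^-1 :> R by rewrite invr_gt0.
have ab : n.+2%:R^-1 < n.+2%:R :> R.
  by apply: (@lt_trans _ _ 1); [rewrite invf_lt1// ltr1n|rewrite ltr1n].
rewrite (FTC_pos i0 ab cf dF) lee_fin; apply: (le_trans (ler_norm _)).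
apply: (le_trans (ler_normB _ _)).
by rewrite lerD// FM.
Qed.

(** An integrable derivative on the half-line of a function vanishing at both
    ends has integral zero. *)
Lemma integral_derivative_eq0 f F :
  mu.-integrable `]0, +oo[ (EFin \o f) ->
  (forall x : R, 0 < x -> {for x, continuous f}) ->
  (forall x : R, 0 < x -> is_derive x 1 F (f x)) ->
  (fun n => F n.+1%:R^-1) @ \oo --> 0 -> (fun n => F n.+1%:R) @ \oo --> 0 ->
  \int[mu]_(x in `]0, +oo[) f x = 0.
Proof.
move=> if_ cf dF F0 Fy.
have mf := continuous_pos_measurable cf.
pose f_ n := f \_ (exhaust_itv n).
have c1 : (fun n => \int[mu]_(x in `]0%R, +oo[) (f_ n x)%:E)%E @ \oo -->
          (\int[mu]_(x in `]0%R, +oo[) (f x)%:E)%E.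
  have mf_ n : measurable_fun (`]0, +oo[%classic : set R) (f_ n).
    apply/(measurable_restrict f) => //; first exact: measurable_exhaust_itv.
    by apply: measurable_funS mf => //; exact: subIsetl.
  have [||||||_ _ //] := @dominated_convergence _ _ _ mu `]0, +oo[%classic _
     (fun n x => (f_ n x)%:E) (EFin \o f) (fun x => `|f x|%:E).
  - by [].
  - by move=> n; apply/measurable_EFinP; exact: mf_.
  - by apply/measurable_EFinP.
  - apply: aeW => x; rewrite -bigcup_exhaust_itv => -[m _ mx].
    apply: cvg_near_cst; exists m => // n /= mn.
    rewrite /f_ patchE mem_set//.
    by have /subsetPset := exhaust_itv_nd mn; apply.
  - exact: (integrable_norm if_).
  - apply: aeW => x n _; rewrite lee_fin /f_ patchE.
    by case: ifPn => // _; rewrite normr0.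
have c2 : (fun n => \int[mu]_(x in `]0%R, +oo[) (f_ n x)%:E)%E @ \oo --> 0%E.
  rewrite -(cvg_shiftn 1).
  rewrite [X in X @ _ --> _](_ : _ = (fun n => (F (n + 1).+1%:R - F (n + 1).+1%:R^-1)%:E)).
    apply: cvg_EFin; first exact: nearW.
    rewrite -[X in _ --> X]subr0.
    apply: cvgB; first by rewrite (cvg_shiftn 1 (fun n => F n.+1%:R)).
    by rewrite (cvg_shiftn 1 (fun n => F n.+1%:R^-1)).
  apply/funext => n; rewrite addn1.
  have i0 : 0 < n.+2%:R^-1 :> R by rewrite invr_gt0.
  have ab : n.+2%:R^-1 < n.+2%:R :> R.
    by apply: (@lt_trans _ _ 1); [rewrite invf_lt1// ltr1n|rewrite ltr1n].
  rewrite -(FTC_pos i0 ab cf dF).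
  rewrite /f_ /= addn1 [LHS]integral_mkcond [RHS]integral_mkcond.
  congr (integral _ _ _); apply/funext => x; rewrite !patchE /exhaust_itv.
  case: ifPn => //; case: ifPn => // h; rewrite notin_setE => h'; exfalso; apply: h'.
  by apply: (@exhaust_itv_sub n.+1); exact: set_mem.
by rewrite /Rintegral -(cvg_lim _ c1)// (cvg_lim _ c2).
Qed.

End HalfLineIntegrals.

(** * The k-Gamma integral *)

Section KGammaIntegral.
Context {R : realType}.
Notation mu := (@lebesgue_measure R).
Implicit Types (k x y t : R) (z : R[i]).

(** The integrand of the k-Gamma function at a complex argument. *)
Definition kgamma_integrand k z t : R[i] :=
  (expR (- (t `^ k / k)))%:C * cpow t (z - 1).

(** The integrand at a real argument [x], which is also the modulus of the
    integrand at any complex argument of real part [x]. *)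
Definition kgamma_weight k x t : R := expR (- (t `^ k / k)) * t `^ (x - 1).

(** The k-Gamma integral; it is the k-Gamma function on the half-plane
    [0 < Re z], see [kGammaE], and the Gamma function for [k = 1], see
    [GammaE]. *)
Definition kgamma_int k z : R[i] :=
  cintegral `]0, +oo[ (kgamma_integrand k z).

(** The k-Gamma integral at a real argument, as a real number. *)
Definition rkgamma_int k x : R := \int[mu]_(t in `]0, +oo[) kgamma_weight k x t.

Lemma kgamma_weight_gt0 k x t : 0 < t -> 0 < kgamma_weight k x t.
Proof. by move=> t0; rewrite mulr_gt0 ?expR_gt0 ?powR_gt0. Qed.

Lemma normc_kgamma_integrand k z t : 0 < t ->
  normc (kgamma_integrand k z t) = kgamma_weight k (Re z) t.
Proof.
move=> t0; rewrite Normc.normcM normcR normc_cpow// cReB /=.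
by rewrite ger0_norm ?expR_ge0.
Qed.

Lemma kgamma_integrand_real k x t : 0 < t ->
  kgamma_integrand k x%:C t = (kgamma_weight k x t)%:C.
Proof.
move=> t0; rewrite /kgamma_integrand -[1 : R[i]]/((1 : R)%:C) -rmorphB.
by rewrite cpow_real// -rmorphM.
Qed.

Lemma cmeasurable_kgamma_integrand k z :
  cmeasurable `]0, +oo[ (kgamma_integrand k z).
Proof.
apply: cmeasurableM; last exact: cmeasurable_cpow.
apply: cmeasurable_real; apply: measurableT_comp => //.
apply: measurableT_comp => //; apply: measurable_funM => //.
by apply: (measurable_funS measurableT) => //; exact: measurable_powR.
Qed.

Lemma measurable_kgamma_weight k x (D : set R) : measurable D ->
  measurable_fun D (kgamma_weight k x).
Proof.
move=> mD; apply: (measurable_funS measurableT) => //.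
apply: measurable_funM; last exact: measurable_powR.
apply: measurableT_comp => //.
by apply: measurableT_comp => //; apply: measurable_funM.
Qed.

Lemma expR_ge_expn (N : nat) (s : R) : (0 < N)%N -> 0 <= s ->
  (s / N%:R) ^+ N <= expR s.
Proof.
move=> N0 s0.
have -> : expR s = expR (s / N%:R) ^+ N.
  by rewrite -expRM_natr -mulrA mulVf ?mulr1// pnatr_eq0 -lt0n.
have sN : 0 <= s / N%:R by rewrite divr_ge0.
by rewrite lerXn2r ?nnegrE ?expR_ge0// (le_trans _ (expR_ge1Dx _))// lerDr.
Qed.

(** A function of the order of [t^(x-1)] at 0 and of [t^(-x-1)] at infinity, with
    the bounded antiderivative [- 1 / (1 + t^x)]. *)
Definition power_bump x t : R := x * t `^ (x - 1) / (1 + t `^ x) ^+ 2.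

Lemma power_bump_ge0 x t : 0 <= x -> 0 <= power_bump x t.
Proof.
by move=> x0; rewrite divr_ge0 ?sqr_ge0// mulr_ge0 ?powR_ge0.
Qed.

(** The exponential decay beats [(1 + t^x)^2] by the bound
    [(s / N)^N <= expR s], with [s = t^k / k] and [2 x <= k N]. *)
Lemma kgamma_weight_le k x : 0 < k -> 0 < x ->
  exists2 C, 0 <= C & forall t, 0 < t -> kgamma_weight k x t <= C * power_bump x t.
Proof.
move=> k0 x0.
have [N N0 hN] : exists2 N : nat, (0 < N)%N & 2 * x <= k * N%:R.
  exists (Num.truncn (2 * x / k)).+1 => //.
  by rewrite [leRHS]mulrC -ler_pdivrMr// ltW// truncnS_gt.
have kN0 : 0 <= (k * N%:R) ^+ N by rewrite exprn_ge0// mulr_ge0// ltW.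
pose C := (4 + 4 * (k * N%:R) ^+ N) / x.
exists C; first by rewrite divr_ge0 ?addr_ge0 ?mulr_ge0// ltW.
move=> t t0.
have px0 : 0 <= t `^ x by exact: powR_ge0.
have D0 : 0 < (1 + t `^ x) ^+ 2 by rewrite exprn_gt0// ltr_wpDr.
suff H : expR (- (t `^ k / k)) * (1 + t `^ x) ^+ 2 <= 4 + 4 * (k * N%:R) ^+ N.
  rewrite /kgamma_weight /power_bump.
  have -> : C * (x * t `^ (x - 1) / (1 + t `^ x) ^+ 2) =
     (4 + 4 * (k * N%:R) ^+ N) / (1 + t `^ x) ^+ 2 * t `^ (x - 1).
    by rewrite /C; field; rewrite (gt_eqF x0) /= gt_eqF// ltr_wpDr.
  by rewrite ler_wpM2r ?powR_ge0// ler_pdivlMr.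
have p1 : 1 `^ x = 1 by rewrite powR1.
have [t1|t1] := leP t 1.
  apply: (@le_trans _ _ 4); last by rewrite lerDl mulr_ge0.
  have h1 : expR (- (t `^ k / k)) <= 1.
    by rewrite expR_le1 oppr_le0 divr_ge0 ?powR_ge0// ltW.
  have h2 : t `^ x <= 1.
    by rewrite -[leRHS]p1 ge0_ler_powR// ?nnegrE ltW.
  have h3 : (1 + t `^ x) ^+ 2 <= 4 by nra.
  by rewrite -[leRHS]mul1r ler_pM ?expR_ge0 ?sqr_ge0.
apply: (@le_trans _ _ (4 * (k * N%:R) ^+ N)); last by rewrite lerDr.
have h2 : 1 <= t `^ x.
  by rewrite -[leLHS]p1 ge0_ler_powR// ?nnegrE ltW// (lt_trans _ t1).
have h3 : (1 + t `^ x) ^+ 2 <= 4 * (t `^ x) ^+ 2 by nra.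
have h4 : (t `^ x) ^+ 2 <= (t `^ k) ^+ N.
  have -> : (t `^ x) ^+ 2 = t `^ (2 * x).
    by rewrite mulrC powRrM powR_mulrn// powR_ge0.
  have -> : (t `^ k) ^+ N = t `^ (k * N%:R).
    by rewrite powRrM powR_mulrn// powR_ge0.
  by rewrite ler_powR// ltW.
have s0 : 0 <= t `^ k / k by rewrite divr_ge0 ?powR_ge0// ltW.
have h5 := expR_ge_expn N0 s0.
have h6 : (t `^ k) ^+ N = (k * N%:R) ^+ N * (t `^ k / k / N%:R) ^+ N.
  rewrite -exprMn; congr (_ ^+ _); field.
  by rewrite (gt_eqF k0) andbT pnatr_eq0 -lt0n.
rewrite expRN mulrC ler_pdivrMr ?expR_gt0//.
apply: (le_trans h3); rewrite -mulrA ler_wpM2l//.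
by apply: (le_trans h4); rewrite h6 ler_wpM2l.
Qed.

Lemma continuous_powR_pos x t : 0 < t -> {for t, continuous (@powR R ^~ x)}.
Proof.
move=> t0; apply/differentiable_continuous/derivable1_diffP.
by apply: derivable_powR; rewrite in_itv/= t0.
Qed.

Lemma integrable_power_bump x : 0 < x ->
  mu.-integrable `]0, +oo[ (EFin \o power_bump x).
Proof.
move=> x0.
have D0 t : 0 < 1 + t `^ x by rewrite ltr_pwDl// powR_ge0.
apply: (@integrable_bounded_antiderivative _ _ (fun t => - (1 + t `^ x)^-1) 1).
- by move=> t t0; exact/power_bump_ge0/ltW.
- move=> t t0.
  have c0 : {for t, continuous (fun t => x * t `^ (x - 1))}.
    apply: continuousM; first exact: cst_continuous.
    exact: continuous_powR_pos.
  apply: (cvgM c0); apply: cvgV; first by rewrite expf_neq0// gt_eqF.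
  have c : {for t, continuous (fun t => 1 + t `^ x)}.
    apply: continuousD; first exact: cst_continuous.
    exact: continuous_powR_pos.
  exact: (cvgM c c).
- move=> t t0.
  have d1 : is_derive t 1 (fun t => 1 + t `^ x) (x * t `^ (x - 1)).
    rewrite -[X in is_derive _ _ _ X]add0r.
    have dp := is_derive1_powR x t0; exact: is_deriveD.
  have d2 : is_derive t 1 (fun t => (1 + t `^ x)^-1)
      (- (1 + t `^ x) ^- 2 *: (x * t `^ (x - 1))).
    have [e1 e2] := d1; split; first by apply: derivableV => //; exact: lt0r_neq0.
    by rewrite deriveV ?e2//; exact: lt0r_neq0.
  have {}d2 := is_deriveN d2.
  apply: is_derive_eq d2 _.
  by rewrite /power_bump scaleNr opprK /GRing.scale /= mulrC.
- move=> t t0; rewrite normrN ger0_norm; last by rewrite invr_ge0 ltW.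
  by rewrite invf_le1// lerDl powR_ge0.
Qed.

Lemma integrable_kgamma_weight k x : 0 < k -> 0 < x ->
  mu.-integrable `]0, +oo[ (EFin \o kgamma_weight k x).
Proof.
move=> k0 x0; have [C C0 hC] := kgamma_weight_le k0 x0.
apply: (le_integrable (mu:=mu) _ _ _
  (integrable_scale C (measurable_itv `]0, +oo[) (integrable_power_bump x0))) => //.
  by apply/measurable_EFinP; exact: measurable_kgamma_weight.
move=> t /pos_itvP t0; rewrite lee_fin.
rewrite ger0_norm ?(ltW (kgamma_weight_gt0 _ _ t0))//.
by rewrite (le_trans (hC _ t0))// ler_norm.
Qed.

Lemma cintegrable_kgamma_integrand k z : 0 < k -> 0 < Re z ->
  cintegrable `]0, +oo[ (kgamma_integrand k z).
Proof.
move=> k0 z0.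
apply: (le_cintegrable _ (cmeasurable_kgamma_integrand k z) _
  (integrable_kgamma_weight k0 z0)) => //.
by move=> t /pos_itvP t0; rewrite normc_kgamma_integrand.
Qed.

Lemma kgamma_int_real k x : kgamma_int k x%:C = (rkgamma_int k x)%:C.
Proof.
rewrite /kgamma_int (@eq_cintegral _ _ _ (fun t => (kgamma_weight k x t)%:C)).
  by apply: complexP; rewrite //= Rintegral_cst// mul0r.
by move=> t /pos_itvP t0; rewrite kgamma_integrand_real.
Qed.

Lemma cvg_inv_powR x : 0 < x -> (fun n => n.+1%:R^-1 `^ x : R) @ \oo --> 0.
Proof.
move=> x0; have /cvg_at_rightP := powR_cvg0 x0; apply; split.
  by move=> n; rewrite invr_gt0.
exact: cvg_harmonic.
Qed.

End KGammaIntegral.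

(** * The functional equation of the k-Gamma integral *)

Section FunctionalEquation.
Context {R : realType}.
Notation mu := (@lebesgue_measure R).
Implicit Types (k x y t : R) (z w : R[i]).

Lemma expR_ln_powR t x : 0 < t -> expR (x * ln t) = t `^ x.
Proof. by move=> t0; rewrite /powR gt_eqF. Qed.

(** Real part of [w * t^z * exp (- t^k / k)]. By [kgamma_primitive_derivativeE]
    its derivative is the real part of [w] times the difference of the two
    integrands of the functional equation; [w = 1] and [w = - i] give its real
    and imaginary parts. *)
Definition kgamma_primitive k z w t : R :=
  expR (Re z * ln t - k^-1 * t `^ k) *
  (Re w * cos (Im z * ln t) - Im w * sin (Im z * ln t)).

(** The derivative of [kgamma_primitive], in expanded form. *)
Definition kgamma_primitive_derivative k z w t : R :=
  expR (Re z * ln t - k^-1 * t `^ k) *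
  ((Re z / t - t `^ (k - 1)) * (Re w * cos (Im z * ln t) - Im w * sin (Im z * ln t))
   + Im z / t * (- (Re w * sin (Im z * ln t)) - Im w * cos (Im z * ln t))).

Lemma is_derive_kgamma_primitive k z w t : 0 < k -> 0 < t ->
  is_derive t 1 (kgamma_primitive k z w) (kgamma_primitive_derivative k z w t).
Proof.
move=> k0 t0.
have dln := is_derive1_ln t0.
have dpw := is_derive1_powR k t0.
have dth : is_derive t 1 (fun t => Im z * ln t) (Im z * t^-1) := is_deriveZ (Im z) dln.
have dg : is_derive t 1 (fun t => Re z * ln t - k^-1 * t `^ k)
    (Re z * t^-1 - k^-1 * (k * t `^ (k - 1))) :=
  is_deriveB (is_deriveZ (Re z) dln) (is_deriveZ k^-1 dpw).
have dE : is_derive t 1 (fun t => expR (Re z * ln t - k^-1 * t `^ k)) _ :=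
  is_derive1_comp (is_derive_expR _) dg.
have dc : is_derive t 1 (fun t => cos (Im z * ln t)) _ :=
  is_derive1_comp (is_derive_cos _) dth.
have ds : is_derive t 1 (fun t => sin (Im z * ln t)) _ :=
  is_derive1_comp (is_derive_sin _) dth.
have d := is_deriveM dE (is_deriveB (is_deriveZ (Re w) dc) (is_deriveZ (Im w) ds)).
apply: (is_derive_eq d).
rewrite /kgamma_primitive_derivative /= /GRing.scale /=.
rewrite -[(_ - _) t]/(Re w * cos (Im z * ln t) - Im w * sin (Im z * ln t)).
rewrite [k^-1 * (k * _)]mulrA mulVf ?gt_eqF// mul1r.
set e := expR _; set c := cos _; set s := sin _.
ring.
Qed.

Lemma continuous_kgamma_primitive_derivative k z w t : 0 < t ->
  {for t, continuous (kgamma_primitive_derivative k z w)}.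
Proof.
move=> t0.
have cln : {for t, continuous (@ln R)} := continuous_ln t0.
have cc (r : R) : {for t, continuous (fun _ : R => r)} := @cst_continuous R R r t.
have ci : {for t, continuous (fun t : R => t^-1)} by apply: inv_continuous; rewrite gt_eqF.
have cth : {for t, continuous (fun t => Im z * ln t)}.
  exact: (continuousM (cc _) cln).
have ccos : {for t, continuous (fun t => cos (Im z * ln t))}.
  by apply: (continuous_comp cth); exact: continuous_cos.
have csin : {for t, continuous (fun t => sin (Im z * ln t))}.
  by apply: (continuous_comp cth); exact: continuous_sin.
have ce : {for t, continuous (fun t => expR (Re z * ln t - k^-1 * t `^ k))}.
  have c1 : {for t, continuous (fun t => Re z * ln t - k^-1 * t `^ k)}.
    by apply: (continuousB (continuousM (cc _) cln)
      (continuousM (cc _) (continuous_powR_pos t0))).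
  by apply: (continuous_comp c1); exact: continuous_expR.
have c1 : {for t, continuous (fun t => Re z / t - t `^ (k - 1))}.
  exact: (continuousB (continuousM (cc _) ci) (continuous_powR_pos t0)).
have c2 : {for t, continuous
    (fun t => Re w * cos (Im z * ln t) - Im w * sin (Im z * ln t))}.
  exact: (continuousB (continuousM (cc _) ccos) (continuousM (cc _) csin)).
have c3 : {for t, continuous
    (fun t => - (Re w * sin (Im z * ln t)) - Im w * cos (Im z * ln t))}.
  exact: (continuousB (continuousN (continuousM (cc _) csin)) (continuousM (cc _) ccos)).
exact: (continuousM ce (continuousD (continuousM c1 c2)
  (continuousM (continuousM (cc _) ci) c3))).
Qed.

Lemma Re_kgamma_integrand k z t : Re (kgamma_integrand k z t) =
  expR (- (t `^ k / k)) * (expR ((Re z - 1) * ln t) * cos (Im z * ln t)).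
Proof. by rewrite cReMr Re_cpow cReB cImB subr0. Qed.

Lemma Im_kgamma_integrand k z t : Im (kgamma_integrand k z t) =
  expR (- (t `^ k / k)) * (expR ((Re z - 1) * ln t) * sin (Im z * ln t)).
Proof. by rewrite cImMr Im_cpow cReB cImB subr0. Qed.

Let Re_lin w z a b : Re (w * (z * a + (-1) * b)) =
  Re w * (Re z * Re a - Im z * Im a - Re b) -
  Im w * (Re z * Im a + Im z * Re a - Im b).
Proof. by rewrite mulN1r cReM cReB cImB cReM cImM. Qed.

Lemma kgamma_primitive_derivativeE k z w t : 0 < t ->
  kgamma_primitive_derivative k z w t =
  Re (w * (z * kgamma_integrand k z t + (-1) * kgamma_integrand k (z + k%:C) t)).
Proof.
move=> t0.
have Wt : expR (Re z * ln t - k^-1 * t `^ k) =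
    expR (- (t `^ k / k)) * expR ((Re z - 1) * ln t) * t.
  have tE : t = expR (ln t) by rewrite lnK.
  by rewrite [X in _ = _ * X]tE -!expRD; congr expR; ring.
have Tt : t `^ (k - 1) = t `^ k / t.
  by rewrite -(@expR_ln_powR t (k - 1))// mulrBl mul1r expRB lnK// expR_ln_powR.
have Xt : expR ((Re z + k - 1) * ln t) = expR ((Re z - 1) * ln t) * t `^ k.
  by rewrite -(@expR_ln_powR t k)// -expRD; congr expR; ring.
rewrite /kgamma_primitive_derivative Wt Tt.
have t1 := gt_eqF t0.
rewrite Re_lin !Re_kgamma_integrand !Im_kgamma_integrand !(cReD z, cImD z) addr0 Xt.
set c := cos _; set s := sin _; set W := expR _; set X := expR _.
field.
by rewrite t1.
Qed.

(** The primitive vanishes at both ends of the half-line. *)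
Lemma kgamma_primitive_le k z w : 0 < k -> 0 < Re z ->
  exists C, forall t, 0 < t ->
    `|kgamma_primitive k z w t| <= C * t `^ Re z /\
    `|kgamma_primitive k z w t| <= C * t^-1 `^ Re z.
Proof.
move=> k0 z0; have [C C0 hC] := kgamma_weight_le k0 z0.
set x := Re z in z0 hC *.
exists ((`|Re w| + `|Im w|) * (C * x)) => t t0.
have t1 := gt_eqF t0.
have ax : 0 < t `^ x by exact: powR_gt0.
have h : `|kgamma_primitive k z w t| <= (`|Re w| + `|Im w|) *
    (C * x * (t `^ x / (1 + t `^ x) ^+ 2)).
  rewrite /kgamma_primitive normrM ger0_norm ?expR_ge0// mulrC.
  apply: ler_pM => //.
    apply: (le_trans (ler_normB _ _)); rewrite !normrM.
    by apply: lerD; rewrite ler_piMr// ?cos_max ?sin_max.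
  have := hC t t0; rewrite /kgamma_weight /power_bump => /(ler_wpM2r (ltW t0)).
  have -> : t `^ (x - 1) = t `^ x / t.
    by rewrite -(@expR_ln_powR t (x - 1))// mulrBl mul1r expRB lnK// expR_ln_powR.
  have -> : expR (- (t `^ k / k)) * (t `^ x / t) * t = expR (x * ln t - k^-1 * t `^ k).
    by rewrite mulrA divfK ?t1// -(@expR_ln_powR t x)// -expRD addrC [k^-1 * _]mulrC.
  move=> /le_trans; apply.
  rewrite le_eqVlt; apply/orP; left; apply/eqP; field.
  by rewrite t1 /= gt_eqF// addr_gt0.
have pos : 0 <= (`|Re w| + `|Im w|) * (C * x).
  by rewrite mulr_ge0 ?addr_ge0// mulr_ge0// ltW.
split; apply: (le_trans h); rewrite mulrA ler_wpM2l//.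
- rewrite ler_pdivrMr ?exprn_gt0 ?addr_gt0//.
  nra.
- have -> : t^-1 `^ x = (t `^ x)^-1.
    by rewrite -powRN -(@expR_ln_powR t)// -(@expR_ln_powR t^-1) ?invr_gt0//
      lnV ?posrE// mulrN mulNr.
  rewrite ler_pdivrMr ?exprn_gt0 ?addr_gt0// mulrC ler_pdivlMr//.
  nra.
Qed.

Lemma cvg_le_inv_powR (u : R^nat) x C : 0 < x ->
  (forall n, `|u n| <= C * n.+1%:R^-1 `^ x) -> u @ \oo --> 0.
Proof.
move=> x0 uC; apply/norm_cvg0P.
apply: (@squeeze_cvgr _ _ _ _ (cst 0) (fun n => C * n.+1%:R^-1 `^ x)).
- by apply: nearW => n; rewrite normr_ge0/=.
- exact: cvg_cst.
- rewrite -[X in _ --> X](mulr0 C); apply: cvgM; first exact: cvg_cst.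
  exact: cvg_inv_powR.
Qed.

(** The functional equation, by integration of the derivative of
    [t^z * exp (- t^k / k)]. *)
Lemma kgamma_intS k z : 0 < k -> 0 < Re z ->
  kgamma_int k (z + k%:C) = z * kgamma_int k z.
Proof.
move=> k0 z0.
have zk0 : 0 < Re (z + k%:C) by rewrite cReD addr_gt0.
have i1 := cintegrable_kgamma_integrand k0 z0.
have i2 := cintegrable_kgamma_integrand k0 zk0.
have mI : measurable (`]0, +oo[%classic : set R) by [].
have i3 := cintegrableZ z mI i1.
have i4 := cintegrableZ (-1) mI i2.
have i5 := cintegrableD mI i3 i4.
have key w : Re (w * (z * kgamma_int k z + (-1) * kgamma_int k (z + k%:C))) = 0.
  rewrite /kgamma_int -!cintegralZ// -cintegralD// -cintegralZ//.
  have i6 := cintegrableZ w mI i5.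
  transitivity (\int[mu]_(t in `]0, +oo[) kgamma_primitive_derivative k z w t).
    apply: eq_Rintegral => t /set_mem/pos_itvP t0.
    by rewrite kgamma_primitive_derivativeE.
  have [C hC] := kgamma_primitive_le w k0 z0.
  apply: (@integral_derivative_eq0 _ _ (kgamma_primitive k z w)).
  - apply: (eq_integrable (mu:=mu) mI _ _ _ i6.1) => t /set_mem/pos_itvP t0 /=.
    by rewrite kgamma_primitive_derivativeE.
  - by move=> t t0; exact: continuous_kgamma_primitive_derivative.
  - by move=> t t0; exact: is_derive_kgamma_primitive.
  - apply: (@cvg_le_inv_powR _ (Re z) C) => // n.
    by have [] := hC n.+1%:R^-1 => //; rewrite invr_gt0.
  - apply: (@cvg_le_inv_powR _ (Re z) C) => // n.
    by have [] := hC n.+1%:R.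
apply/eqP; rewrite eq_sym -subr_eq0 -mulN1r; apply/eqP; apply: complexP.
  by rewrite -[LHS]/(Re _) -(mul1r (_ + _)) key.
have := key (0 -i* 1); rewrite cReM [Re (_ -i* _)]/= [Im (_ -i* _)]/=.
by rewrite mul0r sub0r -mulNr opprK mul1r => ->.
Qed.

Lemma rkgamma_intS k x : 0 < k -> 0 < x ->
  rkgamma_int k (x + k) = x * rkgamma_int k x.
Proof.
move=> k0 x0; apply: (@complexI R).
have := @kgamma_intS k x%:C k0 x0.
by rewrite -rmorphD /= !kgamma_int_real -rmorphM.
Qed.

Lemma rkgamma_int_ge0 k x : 0 <= rkgamma_int k x.
Proof.
by apply: Rintegral_ge0 => t /pos_itvP t0; exact/ltW/kgamma_weight_gt0.
Qed.

End FunctionalEquation.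

(** * Lower bounds for the k-Gamma integral *)

Section LowerBounds.
Context {R : realType}.
Notation mu := (@lebesgue_measure R).
Implicit Types (k x y t s : R) (z : R[i]).

(** The part of the integral over [T, T + 1]; with [T] arbitrary it shows that
    the integral outgrows every geometric sequence in [x]. *)
Lemma rkgamma_int_ge k x T : 0 < k -> 0 < x -> 1 <= T ->
  expR (- ((T + 1) `^ k / k)) * (T `^ x / (T + 1)) <= rkgamma_int k x.
Proof.
move=> k0 x0 T1.
have T0 : 0 < T by apply: lt_le_trans T1.
have T10 : 0 < T + 1 by rewrite addr_gt0.
set c := expR _ * _.
pose J : set R := `[T, T + 1]%classic.
have sub : J `<=` (`]0, +oo[%classic : set R).
  by move=> t /=; rewrite !in_itv/= andbT => /andP[/(lt_le_trans T0)].
have ig := integrable_kgamma_weight k0 x0.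
have mw (D : set R) (mD : measurable D) := measurable_kgamma_weight k x mD.
have ec : (\int[mu]_(t in J) c%:E = c%:E)%E.
  rewrite integral_cst//; last exact: measurable_itv.
  rewrite /= /J lebesgue_measure_itv/= lte_fin ltrDl ltr01.
  by rewrite -EFinB addrAC subrr add0r mule1.
have fin : (\int[mu]_(t in `]0%R, +oo[) (kgamma_weight k x t)%:E)%E \is a fin_num.
  exact: (integrable_fin_num (mu:=mu) _ ig).
rewrite -lee_fin fineK// -ec.
have mI : measurable (`]0, +oo[%classic : set R) by [].
have mJ : measurable J by exact: measurable_itv.
apply: (@le_trans _ _ (\int[mu]_(t in J) (kgamma_weight k x t)%:E)%E); last first.
  apply: ge0_subset_integral => //.
    by apply/measurable_EFinP; exact: mw.
  by move=> t /pos_itvP t0; rewrite lee_fin ltW// kgamma_weight_gt0.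
apply: ge0_le_integral => //.
- by move=> t _; rewrite lee_fin mulr_ge0 ?expR_ge0// divr_ge0 ?powR_ge0// ltW.
- by apply/measurable_EFinP; exact: mw.
move=> t; rewrite /J /= in_itv/= => /andP[Tt tT]; rewrite lee_fin.
have t0 : 0 < t by apply: lt_le_trans Tt.
apply: ler_pM; [exact: expR_ge0|by rewrite divr_ge0 ?powR_ge0// ltW| |].
  rewrite ler_expR lerN2 ler_wpM2r ?invr_ge0 ?(ltW k0)//.
  by rewrite ge0_ler_powR ?nnegrE// ltW.
rewrite -(@expR_ln_powR _ t)// mulrBl mul1r expRB lnK// expR_ln_powR//.
apply: ler_pM; [exact: powR_ge0|by rewrite invr_ge0 ltW| |].
  by rewrite ge0_ler_powR ?nnegrE// ltW.
by rewrite lef_pV2 ?posrE.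
Qed.

Lemma rkgamma_int_gt0 k x : 0 < k -> 0 < x -> 0 < rkgamma_int k x.
Proof.
move=> k0 x0; apply: lt_le_trans (rkgamma_int_ge k0 x0 (lexx 1)).
by rewrite mulr_gt0 ?expR_gt0// divr_gt0 ?powR_gt0// addr_gt0.
Qed.

Lemma sqr_sin_le s : sin s ^+ 2 <= s ^+ 2.
Proof.
wlog s0 : s / 0 <= s => [H|].
  have [/H//|sn] := leP 0 s.
  by have := H (- s); rewrite sinN !sqrrN; apply; rewrite oppr_ge0 ltW.
have [|c _] := @MVT_segment R (@sin R) (@cos R) 0 s s0.
  by apply: continuous_subspaceT; exact: continuous_sin.
rewrite sin0 !subr0 => ->; rewrite exprMn ler_piMl ?sqr_ge0//.
Qed.

Lemma cos_ge s : 1 - s ^+ 2 / 2 <= cos s.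
Proof.
have := sqr_sin_le (s / 2).
have -> : cos s = 1 - 2 * sin (s / 2) ^+ 2.
  rewrite [in LHS](_ : s = (s / 2) *+ 2) ?cos_mulr2n ?sin2cos2; first by ring.
  by rewrite -mulr_natr divfK.
by move=> h; nra.
Qed.

Lemma sqr_ln_le s : 0 < s -> ln s ^+ 2 <= 4 * (s + s^-1 - 2).
Proof.
move=> s0; pose v := ln s / 2; pose r := expR v.
have r0 : 0 < r by exact: expR_gt0.
have sr : s = r ^+ 2.
  rewrite /r -[X in X = _](lnK s0) [in LHS](_ : ln s = v *+ 2).
    by rewrite mulr2n expRD.
  by rewrite /v -mulr_natr divfK.
have h1 : 1 + v <= r by exact: expR_ge1Dx.
have h2 : 1 - v <= r^-1 by rewrite -expRN; exact: expR_ge1Dx.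
have -> : ln s = 2 * v by rewrite /v mulrC divfK.
have -> : s + s^-1 - 2 = (r - r^-1) ^+ 2.
  by rewrite sr; field; rewrite gt_eqF.
have rr : r * r^-1 = 1 by rewrite mulfV// gt_eqF.
have i0 : 0 < r^-1 by rewrite invr_gt0.
have [v0|v0] := leP 0 v.
- have r1 : 1 <= r by apply: le_trans h1; rewrite lerDl.
  have i1 : r^-1 <= 1 by rewrite invf_le1.
  have h : v <= r - r^-1 by lra.
  nra.
- have i1 : 1 <= r^-1 by lra.
  have r1 : r <= 1 by rewrite -[r]invrK invf_le1.
  have h : - v <= r^-1 - r by lra.
  nra.
Qed.

(** Far from the origin the modulus at [z] is comparable with the value at
    [Re z]: with [s = t^k / Re z], the mean of [s + 1/s - 2] against the weight
    is [k / (Re z - k)], and it controls the oscillation of [t^(i Im z)]. *)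
Lemma normc_kgamma_int_ge_far k z : 0 < k -> k < Re z ->
  rkgamma_int k (Re z) * (1 - 2 * Im z ^+ 2 / (k * (Re z - k))) <=
  normc (kgamma_int k z).
Proof.
move=> k0 kz; set X := Re z in kz *; set y := Im z.
have X0 : 0 < X by apply: lt_trans kz.
have Xk0 : 0 < X - k by rewrite subr_gt0.
(* [X^(1/k)] is the centre of the weight: dividing by the phase of its power
   [i y] leaves a slowly varying phase. *)
pose c0 := y * (ln X / k).
pose p : R[i] := cos c0 -i* sin c0.
have mI : measurable (`]0, +oo[%classic : set R) by [].
have p1 : normc p = 1.
  by rewrite /p /= sqrrN cos2Dsin2 sqrtr1.
have ii := cintegrable_kgamma_integrand k0 X0.
have ip := cintegrableZ p mI ii.
have iw := integrable_kgamma_weight k0 X0.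
have iwD := integrable_kgamma_weight k0 (addr_gt0 X0 k0).
have iwB := integrable_kgamma_weight k0 Xk0.
have -> : normc (kgamma_int k z) = normc (p * kgamma_int k z).
  by rewrite Normc.normcM p1 mul1r.
rewrite -cintegralZ//.
apply: le_trans (le_trans (ler_norm _) (le_Re_normc _)).
(* [l] is the weight times [1 - q * (s + s^-1 - 2)], where [s = t^k / X]: a
   combination of three weights, so that its integral is known. *)
pose q := 2 * y ^+ 2 / k ^+ 2.
pose l t := (1 + 2 * q) * kgamma_weight k X t +
  ((- (q / X)) * kgamma_weight k (X + k) t + (- (q * X)) * kgamma_weight k (X - k) t).
have i1 := integrable_scale (1 + 2 * q) mI iw.
have i2 := integrable_scale (- (q / X)) mI iwD.
have i3 := integrable_scale (- (q * X)) mI iwB.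
have i4 := integrableD (mu:=mu) mI i2 i3.
have il : mu.-integrable `]0, +oo[ (EFin \o l) := integrableD (mu:=mu) mI i1 i4.
have -> : rkgamma_int k X * (1 - 2 * y ^+ 2 / (k * (X - k))) =
    \int[mu]_(t in `]0, +oo[) l t.
  rewrite RintegralD// RintegralD// !RintegralZl//.
  rewrite -![\int[mu]_(_ in _) _]/(rkgamma_int _ _).
  rewrite (rkgamma_intS k0 X0).
  have -> : rkgamma_int k X = (X - k) * rkgamma_int k (X - k).
    by rewrite -(rkgamma_intS k0 Xk0) subrK.
  by rewrite /q; field; rewrite !gt_eqF.
apply: le_Rintegral => //; first exact: ip.1.
move=> t /pos_itvP t0.
have wD : kgamma_weight k (X + k) t = kgamma_weight k X t * t `^ k.
  rewrite /kgamma_weight -mulrA; congr (_ * _).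
  by rewrite -!expR_ln_powR// -expRD; congr expR; ring.
have wB : kgamma_weight k (X - k) t = kgamma_weight k X t / t `^ k.
  rewrite /kgamma_weight -mulrA; congr (_ * _).
  by rewrite -!expR_ln_powR// -expRN -expRD; congr expR; ring.
pose s := t `^ k / X.
have tk0 : 0 < t `^ k by exact: powR_gt0.
have s0 : 0 < s by rewrite divr_gt0.
have lns : ln s = k * ln t - ln X by rewrite ln_div ?posrE// ln_powR.
have -> : Re (p * kgamma_integrand k z t) =
    kgamma_weight k X t * cos (y / k * ln s).
  rewrite cReM Re_kgamma_integrand Im_kgamma_integrand [Re p]/= [Im p]/=.
  have -> : y / k * ln s = y * ln t - c0.
    by rewrite lns /c0; field; rewrite gt_eqF.
  rewrite cosB /kgamma_weight -(@expR_ln_powR _ t (X - 1))//.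
  rewrite -/X -/y; ring.
have -> : l t = kgamma_weight k X t * (1 - q * (s + s^-1 - 2)).
  rewrite /l wD wB /s; field.
  by rewrite !gt_eqF.
apply: ler_wpM2l; first exact/ltW/kgamma_weight_gt0.
apply: le_trans (cos_ge _).
rewrite lerD2l lerN2 exprMn.
have hs := sqr_ln_le s0.
have -> : (y / k) ^+ 2 * ln s ^+ 2 / 2 = (y ^+ 2 / k ^+ 2 / 2) * ln s ^+ 2.
  by field; rewrite gt_eqF.
have -> : q * (s + s^-1 - 2) = (y ^+ 2 / k ^+ 2 / 2) * (4 * (s + s^-1 - 2)).
  by rewrite /q; field; rewrite !gt_eqF.
by apply: ler_wpM2l => //; rewrite !divr_ge0 ?sqr_ge0.
Qed.

Lemma kgamma_int_shift k z n : 0 < k -> 0 < Re z ->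
  kgamma_int k (z + (n%:R * k)%:C) = kPoch k z n * kgamma_int k z.
Proof.
move=> k0 z0; elim: n => [|n IHn].
  by rewrite mul0r addr0 /kPoch big_ord0 mul1r.
have -> : z + (n.+1%:R * k)%:C = z + (n%:R * k)%:C + k%:C.
  by rewrite -natr1 mulrDl mul1r rmorphD addrA.
rewrite kgamma_intS; [|exact: k0|by rewrite cReD /= ltr_wpDr// mulr_ge0// ltW].
by rewrite IHn mulrA /kPoch big_ord_recr /= [_ * \prod_(_ < _) _]mulrC.
Qed.

Lemma rkgamma_int_shift k x n : 0 < k -> 0 < x ->
  rkgamma_int k (x + n%:R * k) = \prod_(j < n) (x + j%:R * k) * rkgamma_int k x.
Proof.
move=> k0 x0; elim: n => [|n IHn].
  by rewrite mul0r addr0 big_ord0 mul1r.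
have -> : x + n.+1%:R * k = x + n%:R * k + k.
  by rewrite -natr1 mulrDl mul1r addrA.
rewrite rkgamma_intS; [|exact: k0|by rewrite ltr_wpDr// mulr_ge0// ltW].
by rewrite IHn mulrA big_ord_recr /= [_ * \prod_(_ < _) _]mulrC.
Qed.

(** The exponents [(A - k)^-1 - A^-1] telescope along an arithmetic progression
    of step [k]. *)
Lemma normc_le_expR_telescope (A k y : R) : 0 < k -> k < A ->
  normc (A +i* y) <= A * expR (y ^+ 2 / k * ((A - k)^-1 - A^-1)).
Proof.
move=> k0 kA.
have A0 : 0 < A by apply: lt_trans kA.
have Ak : 0 < A - k by rewrite subr_gt0.
set u := y ^+ 2 / k * _.
have hu : (y / A) ^+ 2 <= u.
  have -> : u = y ^+ 2 / (A * (A - k)) by rewrite /u; field; rewrite !gt_eqF.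
  rewrite exprMn ler_wpM2l ?sqr_ge0// exprVn lef_pV2 ?posrE ?mulr_gt0 ?exprn_gt0//.
  by rewrite expr2 ler_pM2l// gerBl ltW.
have u0 : 0 <= u by apply: le_trans hu; rewrite sqr_ge0.
rewrite -(@ler_pXn2r _ 2) ?nnegrE ?normc_ge0 ?mulr_ge0 ?expR_ge0 ?(ltW A0)//.
rewrite sqr_normcE /= exprMn.
have e1 : 1 + u <= expR u by exact: expR_ge1Dx.
have -> : A ^+ 2 + y ^+ 2 = A ^+ 2 * (1 + (y / A) ^+ 2).
  by field; rewrite gt_eqF.
rewrite ler_wpM2l ?sqr_ge0//; nra.
Qed.

Lemma normc_kPoch_le k z n : 0 < k -> k < Re z ->
  normc (kPoch k z n) <= \prod_(j < n) (Re z + j%:R * k) *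
    expR (Im z ^+ 2 / k * ((Re z - k)^-1 - (Re z + n%:R * k - k)^-1)).
Proof.
move=> k0 kz; elim: n => [|n IHn].
  by rewrite /kPoch !big_ord0 Normc.normc1 mul0r addr0 subrr mulr0 expR0 mulr1.
rewrite /kPoch big_ord_recr [X in _ <= X * _]big_ord_recr /= Normc.normcM.
set A := Re z + n%:R * k.
have A0 : k < A by rewrite ltr_wpDr// mulr_ge0// ltW.
have -> : Re z + n.+1%:R * k - k = A.
  by rewrite -natr1 mulrDl mul1r addrA addrK.
have -> : z + (n%:R * k)%:C = A +i* Im z.
  by apply: complexP; rewrite ?cReD ?cImD //= addr0.
rewrite [X in expR X](_ : _ = Im z ^+ 2 / k * ((Re z - k)^-1 - (A - k)^-1) +
   Im z ^+ 2 / k * ((A - k)^-1 - A^-1)); last by ring.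
rewrite expRD mulrACA ler_pM ?normc_ge0//.
exact: normc_le_expR_telescope.
Qed.

(** Shift by [n] steps, with [n] so large that [normc_kgamma_int_ge_far] loses at
    most a factor 2, then divide by the Pochhammer symbols. *)
Lemma normc_kgamma_int_ge k z : 0 < k -> k < Re z ->
  rkgamma_int k (Re z) / 2 * expR (- (Im z ^+ 2 / (k * (Re z - k)))) <=
  normc (kgamma_int k z).
Proof.
move=> k0 kz.
have z0 : 0 < Re z by apply: lt_trans kz.
have zk : 0 < Re z - k by rewrite subr_gt0.
have [n hn] : exists n : nat, 4 * Im z ^+ 2 <= k * (n%:R * k).
  exists (Num.truncn (4 * Im z ^+ 2 / k / k)).+1.
  have := truncnS_gt (4 * Im z ^+ 2 / k / k) => /ltW.
  by rewrite ler_pdivrMr// ler_pdivrMr// [leRHS]mulrC.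
have nk0 : 0 <= n%:R * k by rewrite mulr_ge0// ltW.
have ReE : Re (z + (n%:R * k)%:C) = Re z + n%:R * k by rewrite cReD.
have ImE : Im (z + (n%:R * k)%:C) = Im z by rewrite cImD /= addr0.
have kzn : k < Re (z + (n%:R * k)%:C) by rewrite ReE ltr_wpDr.
have := normc_kgamma_int_ge_far k0 kzn.
rewrite kgamma_int_shift// Normc.normcM ReE ImE rkgamma_int_shift//.
set P := \prod_(j < n) _; set G := rkgamma_int k (Re z).
have G0 : 0 < G by exact: rkgamma_int_gt0.
have P0 : 0 < P.
  by apply: prodr_gt0 => j _; rewrite ltr_wpDr// mulr_ge0// ltW.
have hq : 2 * Im z ^+ 2 / (k * (Re z + n%:R * k - k)) <= 1 / 2.
  have d0 : 0 < Re z + n%:R * k - k by rewrite addrAC ltr_wpDr.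
  rewrite ler_pdivrMr ?mulr_gt0//.
  have : k * (n%:R * k) <= k * (Re z + n%:R * k - k).
    by rewrite ler_pM2l// addrAC lerDr ltW.
  lra.
set Q := 2 * _ / _ in hq * => h1.
have h2 : P * G / 2 <= P * G * (1 - Q).
  by rewrite ler_pM2l ?mulr_gt0//; lra.
have h3 := le_trans h2 h1.
have h4 := normc_kPoch_le n k0 kz.
set E0 := expR _ in h4.
have hE : E0 <= expR (Im z ^+ 2 / (k * (Re z - k))).
  rewrite ler_expR invfM mulrA ler_wpM2l ?divr_ge0 ?sqr_ge0 ?(ltW k0)//.
  by rewrite gerBl invr_ge0 ltW// addrAC ltr_wpDr.
have h5 := le_trans h3 (ler_wpM2r (normc_ge0 (kgamma_int k z)) h4).
rewrite -/P in h5.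
have h6 : G / 2 <= E0 * normc (kgamma_int k z).
  by rewrite -(ler_pM2l P0) !mulrA.
rewrite expRN ler_pdivrMr ?expR_gt0// [leRHS]mulrC.
by apply: (le_trans h6); rewrite ler_wpM2r ?normc_ge0.
Qed.

(** The k-Gamma integral has no zero in the right half-plane. *)
Lemma kgamma_int_neq0 k z : 0 < k -> 0 < Re z -> kgamma_int k z != 0.
Proof.
move=> k0 z0.
have kz : k < Re (z + k%:C) by rewrite cReD /= ltrDr.
have h : 0 < normc (kgamma_int k (z + k%:C)).
  apply: lt_le_trans (normc_kgamma_int_ge k0 kz).
  rewrite mulr_gt0 ?expR_gt0// divr_gt0 ?rkgamma_int_gt0//.
  exact: lt_trans kz.
move: h; rewrite normc_gt0 kgamma_intS//.
by apply: contra => /eqP ->; rewrite mulr0.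
Qed.

End LowerBounds.

(** * Affine changes of variable and convolutions *)

Section AffineChange.
Context {R : realType}.
Notation mu := (@lebesgue_measure R).

Section Affine.
Variables (a b : R).
Hypothesis a0 : (0 < a)%R.

Let aff (x : measurableTypeR R) : measurableTypeR R := (a * x + b)%R.

Let measurable_aff : measurable_fun [set: measurableTypeR R] aff.
Proof.
have : measurable_fun [set: R] (fun x : R => (a * x + b)%R).
  by apply: measurable_funD => //; exact: measurable_funM.
by [].
Qed.

Let affine_pushforward : {measure set (measurableTypeR R) -> \bar R} :=
  measure_function_pushforward__canonical__measure_function_Measure mu measurable_aff.

Let scaled_pushforward : {measure set (measurableTypeR R) -> \bar R} :=
  mscale (NngNum (ltW a0)) affine_pushforward.

(** Lebesgue measure is [a] times its image under [x |-> a * x + b]. *)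
Let affine_measure (A : set R) : measurable A -> mu A = scaled_pushforward A.
Proof.
move=> mA; apply: lebesgue_measure_unique => // _ [[c d]] _ <-.
change (mu `]c, d]%classic = (a%:E * mu (aff @^-1` `]c, d]))%E).
have -> : aff @^-1` `]c, d] = `](c - b) / a, (d - b) / a]%classic.
  apply/seteqP; split => x /=; rewrite !in_itv/= /aff.
    by rewrite ltr_pdivrMr// ler_pdivlMr// ltrBlDr lerBrDr [(x * a)%R]mulrC.
  by rewrite ltr_pdivrMr// ler_pdivlMr// ltrBlDr lerBrDr [(x * a)%R]mulrC.
rewrite /= !lebesgue_measure_itv/= !lte_fin ltr_pM2r ?invr_gt0// ltrD2r.
case: ifPn => _; last by rewrite mule0.
rewrite -!EFinB -EFinM; congr EFin; field.
by rewrite gt_eqF.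
Qed.

Lemma ge0_integral_affine (f : R -> \bar R) :
  measurable_fun [set: R] f -> (forall x, (0 <= f x)%E) ->
  (\int[mu]_x f x = a%:E * \int[mu]_x f (a * x + b)%R)%E.
Proof.
move=> mf f0.
rewrite (eq_measure_integral scaled_pushforward); last first.
  by move=> A mA _; exact: affine_measure.
by rewrite ge0_integral_mscale// ge0_integral_pushforward.
Qed.

End Affine.

Lemma integrable_affine (a b : R) (f : R -> R) : 0 < a ->
  mu.-integrable [set: R] (EFin \o f) ->
  mu.-integrable [set: R] (EFin \o (fun x => f (a * x + b))) /\
  \int[mu]_x f x = a * \int[mu]_x f (a * x + b).
Proof.
move=> a0 if_.
have maff : measurable_fun [set: R] (fun x : R => a * x + b).
  by apply: measurable_funD => //; exact: measurable_funM.
have mf : measurable_fun [set: R] f by case/integrableP: if_ => /measurable_EFinP.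
have mfa : measurable_fun [set: R] (fun x => f (a * x + b)).
  exact: (measurableT_comp mf maff).
have i1 : mu.-integrable [set: R] (EFin \o (fun x => f (a * x + b))).
  apply/integrableP; split; first exact/measurable_EFinP.
  have /integrableP[_] := if_.
  rewrite (@ge0_integral_affine a b)//; last first.
    by apply: measurableT_comp => //; exact/measurable_EFinP.
  rewrite -lte_pdivlMl//; move=> /lt_le_trans; apply.
  by rewrite leey.
split => //.
have mfE : measurable_fun [set: R] (EFin \o f) by exact/measurable_EFinP.
rewrite /Rintegral.
have -> : (\int[mu]_x (f x)%:E = a%:E * \int[mu]_x (f (a * x + b))%:E)%E.
  rewrite integralE [in RHS]integralE muleBr//; last first.
    exact: fin_num_adde_defr (integrable_pos_fin_num (mu:=mu) measurableT i1).
  congr (_ - _)%E.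
  - rewrite (@ge0_integral_affine a b)//; last exact: measurable_funepos.
    by congr (_ * _)%E; apply: eq_integral => x _; rewrite !funeposE.
  - rewrite (@ge0_integral_affine a b)//; last exact: measurable_funeneg.
    by congr (_ * _)%E; apply: eq_integral => x _; rewrite !funenegE.
by rewrite fineM//; exact: (integrable_fin_num (mu:=mu) _ i1).
Qed.

Lemma integrable_restrictT (D : set R) (f : R -> R) : measurable D ->
  mu.-integrable D (EFin \o f) -> mu.-integrable [set: R] (EFin \o (f \_ D)).
Proof.
move=> mD if_; rewrite -restrict_EFin.
by apply/(integrable_mkcond (mu:=mu) (EFin \o f) mD).1.
Qed.

Lemma Rintegral_scale (D : set R) (h : R -> R) r : measurable D ->
  mu.-integrable D (EFin \o h) ->
  \int[mu]_(x in D) (r * h x) = r * \int[mu]_(x in D) h x.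
Proof. by move=> mD ih; rewrite RintegralZl. Qed.

(** Fubini's theorem for the convolution of two integrable functions on the
    half-line. The inner integrand is integrable for almost every [t]; only the
    existence of one positive such [t] is recorded. *)
Lemma convolution_half_line (A B : R -> R) :
  mu.-integrable `]0, +oo[ (EFin \o A) -> mu.-integrable `]0, +oo[ (EFin \o B) ->
  [/\ (\int[mu]_(t in `]0%R, +oo[) \int[mu]_(u in `]0%R, t[) (A u * B (t - u))%:E =
       (\int[mu]_(u in `]0, +oo[) A u * \int[mu]_(u in `]0, +oo[) B u)%:E)%E,
    mu.-integrable `]0, +oo[
      (fun t => \int[mu]_(u in `]0%R, t[) (A u * B (t - u))%:E)%E &
    exists2 t, 0 < t & mu.-integrable `]0, t[ (EFin \o (fun u => A u * B (t - u)))].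
Proof.
move=> iA iB.
pose P : set R := `]0, +oo[%classic.
have mP : measurable P by exact: measurable_itv.
pose A' := A \_ P; pose B' := B \_ P.
have iA' : mu.-integrable [set: R] (EFin \o A') by exact: integrable_restrictT.
have iB' : mu.-integrable [set: R] (EFin \o B') by exact: integrable_restrictT.
have mA' : measurable_fun [set: R] A' by apply/measurable_EFinP; case/integrableP: iA'.
have mB' : measurable_fun [set: R] B' by apply/measurable_EFinP; case/integrableP: iB'.
pose f (p : measurableTypeR R * measurableTypeR R) : \bar R :=
  (A' p.2 * B' (p.1 - p.2))%:E.
have mf : measurable_fun setT f.
  apply/measurable_EFinP; apply: measurable_funM.
    by apply: (measurableT_comp mA').
  by apply: (measurableT_comp mB'); apply: measurable_funB.
have transl (g : R -> \bar R) (u : R) : measurable_fun [set: R] g ->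
    (forall x, (0 <= g x)%E) -> (\int[mu]_t g (t - u)%R = \int[mu]_t g t)%E.
  move=> mg g0; rewrite (@ge0_integral_affine 1 (- u) ltr01 g)// mul1e.
  by apply: eq_integral => t _; rewrite mul1r.
have transl' (u : R) : \int[mu]_t B' (t - u) = \int[mu]_t B' t.
  have [_ ->] := @integrable_affine 1 (- u) B' ltr01 iB'; rewrite mul1r.
  by apply: eq_Rintegral => t _; rewrite mul1r.
have mT : measurable [set: R] by [].
pose c := \int[mu]_t `|B' t|.
have iBn := integrable_norm iB'.
have if_ : (mu \x mu)%E.-integrable setT f.
  apply: (proj2 (@integrable21ltyP _ _ _ _ _ mu mu f mf)).
  have E u : (\int[mu]_t `|f (t, u)| = (c * `|A' u|)%:E)%E.
    transitivity (\int[mu]_t (`|A' u|%:E * (fun s => `|B' s|%:E) (t - u)%R))%E.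
      by apply: eq_integral => t _; rewrite /f /= normrM EFinM.
    rewrite ge0_integralZl//; last first.
      apply/measurable_EFinP; apply: measurableT_comp => //.
      by apply: (measurableT_comp mB'); exact: measurable_funB.
    rewrite (transl (fun s => `|B' s|%:E)) ?EFinM 1?muleC//; last first.
      by apply/measurable_EFinP; exact: measurableT_comp.
    by congr (_ * _)%E; rewrite /c fineK//; exact: (integrable_fin_num (mu:=mu) _ iBn).
  under eq_integral do rewrite E.
  exact: (integrable_lty (mu:=mu) _ (integrable_scale c mT (integrable_norm iA'))).
have FF := Fubini if_.
pose b := \int[mu]_t B' t.
have inner u : (\int[mu]_t f (t, u) = (b * A' u)%:E)%E.
  have [iu _] := @integrable_affine 1 (- u) B' ltr01 iB'.
  have iu' : mu.-integrable [set: R] (EFin \o (fun t => B' (t - u))).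
    by apply: (eq_integrable (mu:=mu) mT _ _ _ iu) => t _ /=; rewrite mul1r.
  have iu2 := integrable_scale (A' u) mT iu'.
  rewrite /f /= -[LHS]fineK; last exact: (integrable_fin_num (mu:=mu) _ iu2).
  congr EFin; rewrite -[LHS]/(\int[mu]_t (A' u * B' (t - u))).
  by rewrite (Rintegral_scale _ mT iu') transl' mulrC.
have L (t : R) : (\int[mu]_u f (t, u) =
    \int[mu]_(u in `]0%R, t[) (A u * B (t - u)%R)%:E)%E.
  rewrite [RHS]integral_mkcond; apply: eq_integral => u _.
  rewrite /f /= /A' /B' !patchE /P !mem_setE !in_itv/= !andbT subr_gt0.
  by case: (0 < u); case: (u < t); rewrite /= ?mul0r ?mulr0; exact: erefl.
have LP (t : R) : (\int[mu]_u f (t, u) =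
    ((fun t => \int[mu]_(u in `]0%R, t[) (A u * B (t - u)%R)%:E) \_ P) t)%E.
  rewrite patchE L /P mem_setE in_itv/= andbT.
  case: ltP => t0; first exact: erefl.
  have -> : `]0, t[%classic = set0 :> set R by rewrite set_itv_ge// bnd_simp -leNgt.
  by rewrite integral_set0.
split.
- rewrite integral_mkcond.
  transitivity (\int[mu]_t \int[mu]_u f (t, u))%E.
    by apply: eq_integral => t _; rewrite LP.
  rewrite FF; under eq_integral do rewrite inner.
  have iA2 := integrable_scale b mT iA'.
  rewrite -[LHS]fineK; last exact: (integrable_fin_num (mu:=mu) _ iA2).
  congr EFin; rewrite -[LHS]/(\int[mu]_t (b * A' t)) (Rintegral_scale _ mT iA') mulrC.
  by rewrite /b /A' /B' -!Rintegral_mkcond.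
- apply/(integrable_mkcond (mu:=mu) _ mP).
  apply: (eq_integrable (mu:=mu) mT _ _ _ (integrable_fubini_F if_)) => t _.
  exact: LP.
(* If no positive [t] worked, the half-line would be negligible. *)
have [N [mN N0 hN]] := ae_integrable1 if_.
apply: contrapT => H.
have sub : (P : set R) `<=` N.
  move=> t /pos_itvP t0; apply: hN => /= it; apply: H; exists t; first exact: t0.
  have mJ : measurable (`]0, t[%classic : set R) by exact: measurable_itv.
  apply/(integrable_mkcond (mu:=mu) _ mJ).
  apply: (eq_integrable (mu:=mu) mT _ _ _ it) => u _.
  rewrite /f /= /A' /B' !patchE /P !mem_setE !in_itv/= !andbT subr_gt0.
  by case: (0 < u); case: (u < t); rewrite /= ?mul0r ?mulr0; exact: erefl.
have h : (lebesgue_measure P <= lebesgue_measure N)%E.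
  exact: (le_measure mu (mem_set mP) (mem_set mN) sub).
have N0' : lebesgue_measure N = 0%E by exact: N0.
by move: h; rewrite N0' /P lebesgue_measure_itv/= ltry.
Qed.

End AffineChange.

(** * The Gamma and k-Gamma functions *)

Section GammaFunctions.
Context {R : realType}.
Implicit Types (k x y t : R) (z : R[i]).

Lemma kGammaE k z : 0 < Re z -> kGamma k z = kgamma_int k z.
Proof.
move=> z0; rewrite /kGamma /gamma_extend /kshift z0 /kPoch big_ord0 invr1 mulr1.
by rewrite /= mul0r addr0.
Qed.

Lemma GammaE z : 0 < Re z -> Gamma z = kgamma_int 1 z.
Proof.
move=> z0; rewrite /Gamma /gamma_extend /kshift z0 /kPoch big_ord0 invr1 !mulr1.
rewrite /= addr0; apply: eq_cintegral => t /pos_itvP t0.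
by rewrite /kgamma_integrand powRr1 ?(ltW t0)// divr1.
Qed.

(** Along an arithmetic progression running to the right, the reciprocal of the
    k-Gamma function grows at most geometrically. *)
Lemma normc_inv_kGamma_le k (lambda delta : R[i]) : 0 < k -> 0 < Re lambda ->
  exists A B, [/\ 0 <= A, 0 <= B &
    forall n : nat, normc (kGamma k (lambda * n%:R + delta))^-1 <= A * B ^+ n].
Proof.
move=> k0 l0.
set al := Re lambda in l0 *; pose be := Im lambda.
pose x n : R := al * n%:R + Re delta; pose y n : R := be * n%:R + Im delta.
have zE n : lambda * n%:R + delta = x n +i* y n.
  apply: complexP.
    by rewrite cReD cReM cRe_nat cIm_nat mulr0 subr0.
  by rewrite cImD cImM cRe_nat cIm_nat mulr0 add0r.
pose D := `|be| + `|Im delta|.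
pose C := 2 * D ^+ 2 / (k * al).
have C0 : 0 <= C.
  by apply: divr_ge0; [rewrite mulr_ge0 ?sqr_ge0|rewrite mulr_ge0// ltW].
pose w := expR (- ((1 + 1) `^ k / k)) * (1 / (1 + 1)) : R.
have w0 : 0 < w by rewrite mulr_gt0 ?expR_gt0// divr_gt0.
have [n0 n00 hn0] : exists2 n0 : nat, (0 < n0)%N &
    2 * (`|Re delta| + k) <= al * n0%:R.
  exists (Num.truncn (2 * (`|Re delta| + k) / al)).+1 => //.
  have := truncnS_gt (2 * (`|Re delta| + k) / al) => /ltW.
  by rewrite ler_pdivrMr// [X in _ <= X]mulrC.
pose a n := normc (kGamma k (lambda * n%:R + delta))^-1.
have big n : (n0 <= n)%N -> a n <= 2 / w * expR C ^+ n.
  move=> nn.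
  have n_gt0 : (0 < n)%N by apply: leq_trans nn.
  have n1 : 1 <= n%:R :> R by rewrite ler1n.
  have nn0 : n0%:R <= n%:R :> R by rewrite ler_nat.
  have xk : al * n%:R / 2 <= x n - k.
    have h1 : al * n0%:R <= al * n%:R by rewrite ler_pM2l.
    have h2 : - `|Re delta| <= Re delta by rewrite lerNl -normrN ler_norm.
    have h3 : 2 * (`|Re delta| + k) <= al * n%:R by exact: le_trans h1.
    have : 2 * (al * n%:R / 2) = al * n%:R by rewrite mulrC divfK.
    rewrite /x; lra.
  have an0 : 0 < al * n%:R by rewrite mulr_gt0// ltr0n.
  have xk0 : 0 < x n - k by apply: lt_le_trans xk; rewrite divr_gt0.
  have kx : k < x n by rewrite -subr_gt0.
  have x0 : 0 < x n by apply: lt_trans kx.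
  have yn : y n ^+ 2 <= D ^+ 2 * n%:R ^+ 2.
    rewrite -exprMn -[leLHS]real_normK ?num_real//.
    rewrite lerXn2r ?nnegrE ?mulr_ge0 ?addr_ge0//.
    apply: (le_trans (ler_normD _ _)); rewrite mulrDl; apply: lerD.
      by rewrite normrM (ger0_norm (ler0n R n)).
    by rewrite ler_peMr.
  have key : y n ^+ 2 / (k * (x n - k)) <= C * n%:R.
    rewrite ler_pdivrMr ?mulr_gt0//; apply: (le_trans yn).
    have -> : D ^+ 2 * n%:R ^+ 2 = C * n%:R * (k * (al * n%:R / 2)).
      by rewrite /C; field; rewrite !gt_eqF.
    apply: ler_wpM2l; first by rewrite mulr_ge0.
    by apply: ler_wpM2l => //; exact: ltW.
  have low := @normc_kgamma_int_ge R k (x n +i* y n) k0 kx.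
  rewrite /= in low.
  have low2 : w / 2 * expR (- (C * n%:R)) <= normc (kgamma_int k (x n +i* y n)).
    apply: le_trans low; apply: ler_pM; [|exact: expR_ge0| |].
    - by rewrite divr_ge0// ltW.
    - rewrite ler_pM2r//; have := rkgamma_int_ge k0 x0 (lexx 1).
      by rewrite powR1.
    - by rewrite ler_expR lerN2.
  rewrite /a zE Normc.normcV kGammaE//.
  have p0 : 0 < w / 2 * expR (- (C * n%:R)) by rewrite mulr_gt0 ?expR_gt0// divr_gt0.
  have -> : 2 / w * expR C ^+ n = (w / 2 * expR (- (C * n%:R)))^-1.
    rewrite expRN -expRM_natr; field.
    by rewrite !gt_eqF ?expR_gt0.
  by rewrite lef_pV2 ?posrE// (lt_le_trans p0).
(* The sum accounts for the finitely many indices below [n0], where the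
   argument may lie outside the half-plane and nothing is assumed. *)
exists (2 / w + \sum_(i < n0) a i), (expR C); split.
- by rewrite addr_ge0 ?divr_ge0 ?(ltW w0)// sumr_ge0// => i _; exact: normc_ge0.
- exact: expR_ge0.
- move=> n; rewrite -/(a n).
  have s0 : 0 <= \sum_(i < n0) a i by rewrite sumr_ge0// => i _; exact: normc_ge0.
  have e1 : 1 <= expR C ^+ n.
    by rewrite exprn_ege1// -[leLHS]expR0 ler_expR.
  have [nn|nn] := leqP n0 n.
    apply: (le_trans (big n nn)); rewrite ler_wpM2r ?exprn_ge0 ?expR_ge0//.
    by rewrite lerDl.
  apply: (@le_trans _ _ (2 / w + \sum_(i < n0) a i)).
    rewrite (bigD1 (Ordinal nn))//= addrCA lerDl addr_ge0 ?divr_ge0 ?(ltW w0)//.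
    by rewrite sumr_ge0// => i _; exact: normc_ge0.
  by rewrite ler_peMr// addr_ge0 ?divr_ge0 ?(ltW w0).
Qed.

End GammaFunctions.

(** * The Beta integral *)

Section BetaIntegral.
Context {R : realType}.
Notation mu := (@lebesgue_measure R).
Implicit Types (x s t u v : R) (a z w : R[i]).

Lemma itv_oo0P t u : (`]0, t[%classic : set R) u -> 0 < u < t.
Proof. by rewrite /= in_itv. Qed.

Lemma complex_eq_Re z w : (forall p, Re (p * z) = Re (p * w)) -> z = w.
Proof.
move=> H; apply: complexP; first by have := H 1; rewrite !mul1r.
have := H (0 -i* 1); rewrite !cReM [Re (_ -i* _)]/= [Im (_ -i* _)]/=.
by rewrite !mul0r !sub0r -!mulNr !opprK !mul1r.
Qed.

(** The substitution [u = c * v]. *)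
Lemma integrable_rescale (f : R -> R) t c : 0 < t -> 0 < c ->
  mu.-integrable `]0, t[ (EFin \o f) ->
  mu.-integrable `]0, t / c[ (EFin \o (fun v => f (c * v))) /\
  \int[mu]_(u in `]0, t[) f u = c * \int[mu]_(v in `]0, t / c[) f (c * v).
Proof.
move=> t0 c0 if_.
pose D : set R := `]0, t[%classic; pose E : set R := `]0, t / c[%classic.
have mD : measurable D by exact: measurable_itv.
have mE : measurable E by exact: measurable_itv.
have mT : measurable [set: R] by [].
have [i1 e1] := @integrable_affine R c 0 (f \_ D) c0 (integrable_restrictT mD if_).
have pE v : (f \_ D) (c * v + 0) = ((fun v => f (c * v)) \_ E) v.
  rewrite !patchE addr0 /D /E !mem_setE !in_itv/= pmulr_rgt0// ltr_pdivlMr//.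
  by rewrite [v * c]mulrC.
split.
  apply/(integrable_mkcond (mu:=mu) _ mE).
  apply: (eq_integrable (mu:=mu) mT _ _ _ i1) => v _.
  by rewrite /= pE !patchE; case: ifP.
rewrite Rintegral_mkcond e1 [in RHS]Rintegral_mkcond; congr (_ * _).
by apply: eq_Rintegral => v _; rewrite pE.
Qed.

(** The integrand of the Beta integral of parameters [x] and [s], rescaled to the
    interval from 0 to [t]. *)
Definition rbeta_integrand x s t u : R := (t - u) `^ (s - 1) * u `^ (x - 1).

(** The same with a complex first parameter: up to the factor [1 / Gamma s], its
    integral is the Riemann-Liouville integral of order [s] of [u^(a-1)]. *)
Definition cbeta_integrand a s t u : R[i] :=
  ((t - u) `^ (s - 1))%:C * cpow u (a - 1).

(** The Beta function at real parameters, and then at a complex first one. *)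
Definition rbeta x s : R := \int[mu]_(v in `]0, 1[) rbeta_integrand x s 1 v.

Definition cbeta a s : R[i] := cintegral `]0, 1[ (cbeta_integrand a s 1).

Lemma kgamma_weight1 x t : 0 < t ->
  kgamma_weight 1 x t = expR (- t) * t `^ (x - 1).
Proof. by move=> t0; rewrite /kgamma_weight powRr1 ?(ltW t0)// divr1. Qed.

Lemma rbeta_integrand_rescale x s t c v : 0 < v < t / c -> 0 < c ->
  rbeta_integrand x s t (c * v) =
  c `^ (s - 1) * c `^ (x - 1) * rbeta_integrand x s (t / c) v.
Proof.
move=> /andP[v0 vt] c0; rewrite /rbeta_integrand.
have -> : t - c * v = c * (t / c - v) by field; rewrite gt_eqF.
by rewrite !powRM ?subr_ge0 ?(ltW c0) ?(ltW v0) ?(ltW vt)//; ring.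
Qed.

(** Fubini's theorem gives integrability for one value of [t], homogeneity then
    gives it for all of them. *)
Lemma integrable_rbeta x s t : 0 < x -> 0 < s -> 0 < t ->
  mu.-integrable `]0, t[ (EFin \o rbeta_integrand x s t).
Proof.
move=> x0 s0 t0.
have [_ _ [r r0 ir]] := convolution_half_line
  (integrable_kgamma_weight ltr01 x0) (integrable_kgamma_weight ltr01 s0).
have mJ (q : R) : measurable (`]0, q[%classic : set R) by exact: measurable_itv.
have i1 : mu.-integrable `]0, r[ (EFin \o rbeta_integrand x s r).
  apply: (eq_integrable (mu:=mu) (mJ r) _ _ _
    (integrable_scale (expR r) (mJ r) ir)) => u /set_mem/itv_oo0P/andP[u0 ur].
  rewrite /= !kgamma_weight1 ?subr_gt0// /rbeta_integrand.
  rewrite opprB expRB expRN; congr EFin; field.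
  by rewrite !gt_eqF ?expR_gt0.
pose c := r / t.
have c0 : 0 < c by rewrite divr_gt0.
have rc : r / c = t by rewrite /c; field; rewrite !gt_eqF.
have [i2 _] := integrable_rescale r0 c0 i1.
rewrite rc in i2.
apply: (eq_integrable (mu:=mu) (mJ t) _ _ _
    (integrable_scale (c `^ (s - 1) * c `^ (x - 1))^-1 (mJ t) i2)).
move=> u /set_mem/itv_oo0P hu.
rewrite /= rbeta_integrand_rescale ?rc//; congr EFin.
by rewrite mulKf// mulf_neq0// gt_eqF// powR_gt0.
Qed.

Lemma measurable_RL_kernel s t (D : set R) : measurable D ->
  measurable_fun D (fun u => (t - u) `^ (s - 1)).
Proof.
move=> mD; apply: (measurable_funS measurableT) => //.
apply: (measurableT_comp (measurable_powR _)); exact: measurable_funB.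
Qed.

Lemma cintegrable_cbeta a s t : 0 < Re a -> 0 < s -> 0 < t ->
  cintegrable `]0, t[ (cbeta_integrand a s t).
Proof.
move=> a0 s0 t0.
apply: (le_cintegrable _ _ _ (integrable_rbeta a0 s0 t0)) => //.
- apply: cmeasurableM; last exact: cmeasurable_cpow.
  by apply: cmeasurable_real; exact: measurable_RL_kernel.
- move=> u /itv_oo0P/andP[u0 ut].
  by rewrite Normc.normcM normcR normc_cpow// cReB ger0_norm ?powR_ge0.
Qed.

Lemma cintegral_cbeta a s t : 0 < Re a -> 0 < s -> 0 < t ->
  cintegral `]0, t[ (cbeta_integrand a s t) = cpow t (a + s%:C - 1) * cbeta a s.
Proof.
move=> a0 s0 t0.
have [i1 i2] := cintegrable_cbeta a0 s0 t0.
have [_ e1] := integrable_rescale t0 t0 i1.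
have [_ e2] := integrable_rescale t0 t0 i2.
have t1 : t / t = 1 by rewrite divff// gt_eqF.
rewrite t1 in e1 e2.
have -> : cintegral `]0, t[ (cbeta_integrand a s t) =
    t%:C * cintegral `]0, 1[ (fun v => cbeta_integrand a s t (t * v)).
  by apply: complexP; rewrite ?cReMr ?cImMr; [exact: e1|exact: e2].
have mJ : measurable (`]0, 1[%classic : set R) by exact: measurable_itv.
have ic := cintegrable_cbeta a0 s0 (@ltr01 R).
rewrite /cbeta (@eq_cintegral _ _ _ (fun v =>
  ((t `^ (s - 1))%:C * cpow t (a - 1)) * cbeta_integrand a s 1 v)); last first.
  move=> v /itv_oo0P/andP[v0 v1]; rewrite /cbeta_integrand cpowM//.
  have -> : (t - t * v) `^ (s - 1) = t `^ (s - 1) * (1 - v) `^ (s - 1).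
    by rewrite -powRM ?subr_ge0 ?(ltW v1) ?(ltW t0)//; congr powR; ring.
  by rewrite (rmorphM (real_complex R)) mulrACA.
rewrite cintegralZ// mulrA; congr (_ * _).
rewrite mulrA -(rmorphM (real_complex R)) mulr_powRB1 ?(ltW t0)//.
rewrite -[X in X * _](@cpow_real _ t s t0) -cpowD.
by congr cpow; ring.
Qed.

(** Euler's formula for the Beta integral, by Fubini's theorem. *)
Lemma kgamma_int_cbeta a s : 0 < Re a -> 0 < s ->
  kgamma_int 1 (a + s%:C) * cbeta a s = kgamma_int 1 a * (rkgamma_int 1 s)%:C.
Proof.
move=> a0 s0.
have as0 : 0 < Re (a + s%:C) by rewrite cReD addr_gt0.
have mP : measurable (`]0, +oo[%classic : set R) by [].
have ia := cintegrable_kgamma_integrand ltr01 a0.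
have ias := cintegrable_kgamma_integrand ltr01 as0.
have is_ := integrable_kgamma_weight ltr01 s0.
apply: complex_eq_Re => p.
have [iA _] := cintegrableZ p mP ia.
have [conv _ _] := convolution_half_line iA is_.
have inner t : 0 < t ->
    (\int[mu]_(u in `]0%R, t[)
       (Re (p * kgamma_integrand 1 a u) * kgamma_weight 1 s (t - u)%R)%:E =
     (Re ((p * cbeta a s) * kgamma_integrand 1 (a + s%:C) t))%:E)%E.
  move=> t0.
  have mJ : measurable (`]0, t[%classic : set R) by exact: measurable_itv.
  have ib := cintegrable_cbeta a0 s0 t0.
  have ib2 := cintegrableZ (p * (expR (- t))%:C) mJ ib.
  have E : {in (`]0, t[%classic : set R), forall u,
      Re (p * (expR (- t))%:C * cbeta_integrand a s t u) =
      Re (p * kgamma_integrand 1 a u) * kgamma_weight 1 s (t - u)}.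
    move=> u /set_mem/itv_oo0P/andP[u0 ut].
    rewrite kgamma_weight1 ?subr_gt0// /cbeta_integrand /kgamma_integrand.
    rewrite powRr1 ?(ltW u0)// divr1 [RHS]mulrC -cReMr; congr Re.
    have -> : expR (- t) = expR (- u) * expR (- (t - u)).
      by rewrite -expRD; congr expR; ring.
    by rewrite !rmorphM; ring.
  have iE : mu.-integrable `]0, t[ (EFin \o (fun u =>
      Re (p * kgamma_integrand 1 a u) * kgamma_weight 1 s (t - u))).
    by apply: (eq_integrable (mu:=mu) mJ _ _ _ ib2.1) => u uJ /=; rewrite E.
  rewrite -[LHS]fineK; last exact: (integrable_fin_num (mu:=mu) mJ iE).
  congr EFin; transitivity (Re (cintegral `]0, t[
    (fun u => p * (expR (- t))%:C * cbeta_integrand a s t u))).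
    by apply: eq_Rintegral => u uJ; rewrite E.
  rewrite cintegralZ// cintegral_cbeta//; congr Re.
  rewrite /kgamma_integrand powRr1 ?(ltW t0)// divr1; ring.
have iL := cintegrableZ (p * cbeta a s) mP ias.
have LE : Re (p * (kgamma_int 1 (a + s%:C) * cbeta a s)) =
    \int[mu]_(u in `]0, +oo[) Re (p * kgamma_integrand 1 a u) * rkgamma_int 1 s.
  have -> : p * (kgamma_int 1 (a + s%:C) * cbeta a s) =
      cintegral `]0, +oo[ (fun t => (p * cbeta a s) * kgamma_integrand 1 (a + s%:C) t).
    by rewrite cintegralZ// /kgamma_int; ring.
  apply: EFin_inj; rewrite -conv /= fineK; last first.
    exact: (integrable_fin_num (mu:=mu) mP iL.1).
  by apply: eq_integral => t /set_mem/pos_itvP t0; rewrite inner.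
rewrite LE mulrA [p * _ * _]mulrC cReMr mulrC; congr (_ * _).
by rewrite /kgamma_int -cintegralZ.
Qed.

(** The Riemann-Liouville integral of a power, without the factor
    [1 / Gamma s]. *)
Lemma cintegral_RL_power a s t : 0 < Re a -> 0 < s -> 0 < t ->
  cintegral `]0, t[ (cbeta_integrand a s t) =
  kgamma_int 1 a * (rkgamma_int 1 s)%:C / kgamma_int 1 (a + s%:C) *
  cpow t (a + s%:C - 1).
Proof.
move=> a0 s0 t0; rewrite cintegral_cbeta// -kgamma_int_cbeta//.
have as0 : 0 < Re (a + s%:C) by rewrite cReD addr_gt0.
have := kgamma_int_neq0 ltr01 as0 => g0.
by rewrite [kgamma_int _ _ * cbeta a s]mulrC mulfK// mulrC.
Qed.

Lemma rbetaE x s : 0 < x -> 0 < s ->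
  rbeta x s = rkgamma_int 1 x * rkgamma_int 1 s / rkgamma_int 1 (x + s).
Proof.
move=> x0 s0.
have cE : cbeta x%:C s = (rbeta x s)%:C.
  rewrite /cbeta (@eq_cintegral _ _ _ (fun v => (rbeta_integrand x s 1 v)%:C)).
    by apply: complexP; rewrite //= Rintegral_cst// mul0r.
  move=> v /itv_oo0P/andP[v0 v1]; rewrite /cbeta_integrand /rbeta_integrand.
  by rewrite -[1 : R[i]]/((1 : R)%:C) -rmorphB cpow_real// rmorphM.
have := @kgamma_int_cbeta x%:C s x0 s0.
rewrite cE -rmorphD /= !kgamma_int_real -!rmorphM => /(@complexI R) <-.
by rewrite mulrC mulKf// gt_eqF// rkgamma_int_gt0// addr_gt0.
Qed.

(** Uniform control of a ratio of Gamma values by the corresponding ratio at the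
    real part, through the Beta integral, which decreases in its first argument. *)
Lemma normc_gamma_ratio_le a s (n : nat) : 0 < Re a -> 0 < s ->
  normc (kgamma_int 1 (a + n%:R) / kgamma_int 1 (a + n%:R + s%:C)) <=
  2 * (rkgamma_int 1 (Re a) / rkgamma_int 1 (Re a + s)).
Proof.
move=> a0 s0.
have an0 : 0 < Re (a + n%:R) by rewrite cReD cRe_nat ltr_wpDr.
have ans0 : 0 < Re (a + n%:R + s%:C) by rewrite cReD addr_gt0.
have g0 := kgamma_int_neq0 ltr01 ans0.
have r0 := rkgamma_int_gt0 ltr01 s0.
have -> : kgamma_int 1 (a + n%:R) / kgamma_int 1 (a + n%:R + s%:C) =
    cbeta (a + n%:R) s * ((rkgamma_int 1 s)^-1)%:C.
  have := kgamma_int_cbeta an0 s0 => e.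
  have r1 : (rkgamma_int 1 s)%:C != 0 :> R[i].
    by rewrite -normc_gt0 normcR gtr0_norm.
  apply: (mulIf g0); rewrite divfK//; apply: (mulIf r1); rewrite -e.
  rewrite fmorphV; field.
  by rewrite r1.
rewrite Normc.normcM normcR gtr0_norm ?invr_gt0//.
have -> : rkgamma_int 1 (Re a) / rkgamma_int 1 (Re a + s) =
    rbeta (Re a) s / rkgamma_int 1 s.
  by rewrite (rbetaE a0 s0) mulrAC mulfK// (gt_eqF r0).
rewrite mulrA ler_wpM2r ?invr_ge0 ?(ltW r0)//.
have mJ : measurable (`]0, 1[%classic : set R) by exact: measurable_itv.
have [ic1 ic2] := cintegrable_cbeta an0 s0 (@ltr01 R).
apply: (normc_cintegral_le mJ _ _ (integrable_rbeta a0 s0 (@ltr01 R))).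
  exact: (cintegrable_cmeasurable mJ (conj ic1 ic2)).
move=> v /itv_oo0P/andP[v0 v1].
rewrite Normc.normcM normcR normc_cpow// ger0_norm ?powR_ge0//.
rewrite /rbeta_integrand ler_wpM2l ?powR_ge0//.
rewrite cReB cReD cRe_nat /=; apply: ger_powR; first by rewrite v0 ltW.
by rewrite lerD2r lerDl.
Qed.

End BetaIntegral.

(** * Solution of the equation by Mittag-Leffler series *)

Section MittagLefflerSeries.
Context {R : realType}.
Notation leb := (@lebesgue_measure R).
Variables (q nu : R).
Hypothesis nu0 : 0 < nu.
Implicit Types (x t u : R) (a : R[i]).

(** The kernel of the Riemann-Liouville integral applied to [f]. *)
Definition RL_kernel (f : R -> R[i]) t u : R[i] := ((t - u) `^ (nu - 1))%:C * f u.

(** [Gamma a / Gamma (a + m * nu)]. *)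
Definition ml_coef a (m : nat) : R[i] :=
  kgamma_int 1 a / kgamma_int 1 (a + (m%:R * nu)%:C).

(** The m-th iterate of [q] times the Riemann-Liouville integral of order [nu],
    applied to [u^(a-1)]. *)
Definition ml_term a (m : nat) u : R[i] :=
  (q ^+ m)%:C * ml_coef a m * cpow u (a + (m%:R * nu)%:C - 1).

(** The Neumann series with initial term [u^(a-1)]; up to the factor
    [Gamma a * u^(a-1)] it is the two-parameter Mittag-Leffler function at
    [q * u^nu]. *)
Definition ml_fun a u : R[i] := csum (ml_term a ^~ u).

(** A bound for the modulus of [ml_coef (a + n%:R) m], uniform in [n], where
    [x = Re a]. *)
Definition ml_bound x (m : nat) : R :=
  2 * (rkgamma_int 1 x / rkgamma_int 1 (x + m%:R * nu)).

Lemma ml_bound_ge0 x m : 0 <= ml_bound x m.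
Proof. by rewrite mulr_ge0// divr_ge0// rkgamma_int_ge0. Qed.

Lemma normc_ml_coef_le a (n m : nat) : 0 < Re a ->
  normc (ml_coef (a + n%:R) m) <= ml_bound (Re a) m.
Proof.
move=> a0; rewrite /ml_coef /ml_bound; case: m => [|m].
  have an0 : 0 < Re (a + n%:R) by rewrite cReD cRe_nat ltr_wpDr.
  rewrite mul0r !addr0 divff ?kgamma_int_neq0// Normc.normc1.
  by rewrite divff ?mulr1 ?ler1n// gt_eqF// rkgamma_int_gt0.
by apply: normc_gamma_ratio_le => //; rewrite mulr_gt0.
Qed.

(** The Gamma function dominates every geometric sequence. *)
Lemma cvg_ml_bound x (y : R) : 0 < x -> 0 <= y ->
  cvgn (series (fun m => y ^+ m * ml_bound x m)).
Proof.
move=> x0 y0.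
(* For such a [T] the terms are bounded by a geometric series of ratio 1/2. *)
have [T T1 hT] : exists2 T, 1 <= T & 2 * y <= T `^ nu.
  exists (Num.max 1 ((2 * y) `^ nu^-1)); first by rewrite le_max lexx.
  apply: (@le_trans _ _ (((2 * y) `^ nu^-1) `^ nu)).
    by rewrite -powRrM mulVf ?gt_eqF// powRr1// mulr_ge0.
  apply: ge0_ler_powR; first exact: ltW.
  - by rewrite nnegrE powR_ge0.
  - by rewrite nnegrE le_max ler01.
  - by rewrite le_max lexx orbT.
have T0 : 0 < T by apply: lt_le_trans T1.
have T10 : 0 < T + 1 by rewrite addr_gt0.
have p0 : 0 < T `^ nu by exact: powR_gt0.
have [g g0 gE] : exists2 g, 0 <= g & rkgamma_int 1 x = g.
  by exists (rkgamma_int 1 x); first exact: rkgamma_int_ge0.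
pose c := expR (- ((T + 1) `^ 1 / 1)) * (T `^ x / (T + 1)).
have c0 : 0 < c by rewrite mulr_gt0 ?expR_gt0// divr_gt0// powR_gt0.
apply: (@series_le_cvg _ _ (geometric (2 * (g / c)) 2^-1)).
- by move=> m; rewrite mulr_ge0 ?exprn_ge0// ml_bound_ge0.
- move=> m; rewrite /geometric /=; apply: mulr_ge0.
    by rewrite mulr_ge0// divr_ge0// ltW.
  by rewrite exprn_ge0// invr_ge0.
- move=> m; rewrite /geometric /= /ml_bound gE.
  have xm : 0 < x + m%:R * nu by rewrite ltr_wpDr// mulr_ge0// ltW.
  have low : c * (T `^ nu) ^+ m <= rkgamma_int 1 (x + m%:R * nu).
    apply: le_trans (rkgamma_int_ge ltr01 xm T1).
    rewrite /c -mulrA ler_wpM2l ?expR_ge0// mulrAC ler_wpM2r ?invr_ge0 ?(ltW T10)//.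
    rewrite powRD; last by rewrite (gt_eqF T0) implybT.
    by rewrite [m%:R * nu]mulrC powRrM powR_mulrn ?powR_ge0.
  have cp0 : 0 < c * (T `^ nu) ^+ m by rewrite mulr_gt0// exprn_gt0.
  move: (rkgamma_int 1 (x + m%:R * nu)) low => r low.
  have r0 : 0 < r by apply: lt_le_trans low.
  have h1 : g / r <= g / (c * (T `^ nu) ^+ m).
    by rewrite ler_wpM2l// lef_pV2.
  have h2 : y ^+ m <= (T `^ nu * 2^-1) ^+ m.
    by rewrite lerXn2r ?nnegrE ?mulr_ge0 ?powR_ge0 ?invr_ge0// ler_pdivlMr// mulrC.
  apply: (@le_trans _ _ ((T `^ nu * 2^-1) ^+ m * (2 * (g / (c * (T `^ nu) ^+ m))))).
    apply: ler_pM => //; first exact: exprn_ge0.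
      by rewrite mulr_ge0// divr_ge0// ltW.
    by rewrite ler_pM2l.
  rewrite le_eqVlt; apply/orP; left; apply/eqP.
  rewrite exprMn; field.
  by rewrite expf_neq0 ?gt_eqF.
- apply: is_cvg_geometric_series.
  by rewrite ger0_norm ?invr_ge0// invf_lt1// ltr1n.
Qed.

(** The sum of the bounds of the terms of [ml_fun] up to time [t]. *)
Definition ml_total x t : R :=
  limn (series (fun m => (`|q| * t `^ nu) ^+ m * ml_bound x m)).

Lemma normc_ml_term_le a (n m : nat) t u : 0 < Re a -> 0 < u -> u <= t ->
  normc (ml_term (a + n%:R) m u) <=
  t ^+ n * ((`|q| * t `^ nu) ^+ m * ml_bound (Re a) m) * u `^ (Re a - 1).
Proof.
move=> a0 u0 ut.
have t0 : 0 < t by apply: lt_le_trans ut.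
rewrite /ml_term Normc.normcM (Normc.normcM (q ^+ m)%:C) normcR normrX.
rewrite normc_cpow//.
have -> : Re (a + n%:R + (m%:R * nu)%:C - 1) = Re a - 1 + n%:R + m%:R * nu.
  by rewrite cReB !cReD cRe_nat /=; ring.
rewrite powRD; last by rewrite (gt_eqF u0) implybT.
rewrite powRD; last by rewrite (gt_eqF u0) implybT.
rewrite powR_mulrn ?(ltW u0)// [m%:R * nu]mulrC powRrM powR_mulrn ?powR_ge0//.
have h1 := normc_ml_coef_le n m a0.
have h2 : u ^+ n <= t ^+ n by rewrite lerXn2r// nnegrE ltW.
have h3 : (u `^ nu) ^+ m <= (t `^ nu) ^+ m.
  by rewrite lerXn2r ?nnegrE ?powR_ge0// ge0_ler_powR ?nnegrE// ltW.
apply: (@le_trans _ _ (`|q| ^+ m * ml_bound (Re a) m *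
    (u `^ (Re a - 1) * t ^+ n * (t `^ nu) ^+ m))).
  apply: ler_pM.
  - by rewrite mulr_ge0 ?exprn_ge0 ?normc_ge0.
  - by rewrite !mulr_ge0 ?exprn_ge0 ?powR_ge0 ?(ltW u0).
  - by rewrite ler_wpM2l ?exprn_ge0.
  - apply: ler_pM => //.
    + by rewrite mulr_ge0 ?powR_ge0 ?exprn_ge0 ?(ltW u0).
    + by rewrite exprn_ge0 ?powR_ge0.
    + by rewrite ler_wpM2l ?powR_ge0.
rewrite le_eqVlt; apply/orP; left; apply/eqP; rewrite exprMn; ring.
Qed.

Lemma ml_fun_sum a (n : nat) t u : 0 < Re a -> 0 < u -> u <= t ->
  has_csum (ml_term (a + n%:R) ^~ u) (ml_fun (a + n%:R) u) /\
  normc (ml_fun (a + n%:R) u) <= 2 * (t ^+ n * ml_total (Re a) t) * u `^ (Re a - 1).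
Proof.
move=> a0 u0 ut.
have y0 : 0 <= `|q| * t `^ nu by rewrite mulr_ge0 ?powR_ge0.
have c0 := cvg_ml_bound a0 y0.
pose r := t ^+ n * u `^ (Re a - 1).
have cr := @cvg_seriesZ _ _ r _ c0.
have [||l hl nl] := @has_csum_le _ (ml_term (a + n%:R) ^~ u)
    (fun m => r * ((`|q| * t `^ nu) ^+ m * ml_bound (Re a) m)).
- move=> m; apply: (le_trans (normc_ml_term_le n m a0 u0 ut)).
  by rewrite /r [leRHS]mulrAC.
- by apply/cvg_ex; eexists; exact: cr.
- rewrite /ml_fun (has_csum_csum hl); split => //.
  apply: (le_trans nl); rewrite (cvg_lim _ cr)//.
  rewrite le_eqVlt; apply/orP; left; apply/eqP; rewrite /r /ml_total; ring.
Qed.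

(** [q * I] maps each term of the Neumann series to the next one. *)
Lemma RL_ml_term a m t : 0 < Re a -> 0 < t ->
  cintegrable `]0, t[ (RL_kernel (ml_term a m) t) /\
  (q / rkgamma_int 1 nu)%:C * cintegral `]0, t[ (RL_kernel (ml_term a m) t) =
  ml_term a m.+1 t.
Proof.
move=> a0 t0.
pose am := a + (m%:R * nu)%:C.
have am0 : 0 < Re am by rewrite cReD /= ltr_wpDr// mulr_ge0// ltW.
have am1 : 0 < Re (am + nu%:C) by rewrite cReD addr_gt0.
have mJ : measurable (`]0, t[%classic : set R) by exact: measurable_itv.
have ib := cintegrable_cbeta am0 nu0 t0.
pose c := (q ^+ m)%:C * ml_coef a m.
have E u : RL_kernel (ml_term a m) t u = c * cbeta_integrand am nu t u.
  by rewrite /RL_kernel /ml_term /cbeta_integrand -/c -/am; ring.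
split.
  by apply: (eq_cintegrable mJ _ (cintegrableZ c mJ ib)) => u _; rewrite E.
rewrite (@eq_cintegral _ _ _ (fun u => c * cbeta_integrand am nu t u)); last by [].
rewrite (cintegralZ c mJ ib) (cintegral_RL_power am0 nu0 t0).
have amS : am + nu%:C = a + (m.+1%:R * nu)%:C.
  by rewrite /am -addrA -(rmorphD (real_complex R)) -natr1 mulrDl mul1r.
rewrite /ml_term /c /ml_coef -amS -/am.
have g0 := kgamma_int_neq0 ltr01 am0.
have g1 := kgamma_int_neq0 ltr01 am1.
have r0 : (rkgamma_int 1 nu)%:C != 0 :> R[i].
  by rewrite -normc_gt0 normcR gtr0_norm// rkgamma_int_gt0.
have -> : (q / rkgamma_int 1 nu)%:C = q%:C / (rkgamma_int 1 nu)%:C.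
  by rewrite (rmorphM (real_complex R)) fmorphV.
rewrite exprS (rmorphM (real_complex R)).
move: (kgamma_int 1 am) (kgamma_int 1 (am + nu%:C)) (kgamma_int 1 a) g0 g1
  ((rkgamma_int 1 nu)%:C) r0 (cpow t _) => X Y Z X0 Y0 r r0 p.
field.
by rewrite X0 Y0 r0.
Qed.

Lemma ml_term0 a u : 0 < Re a -> ml_term a 0 u = cpow u (a - 1).
Proof.
move=> a0; rewrite /ml_term /ml_coef mul0r !addr0 divff ?kgamma_int_neq0//.
by rewrite expr0 !mul1r.
Qed.

Lemma normc_RL_kernel_le (f : R -> R[i]) (C x t u : R) : 0 < u < t ->
  normc (f u) <= C * u `^ (x - 1) ->
  normc (RL_kernel f t u) <= C * rbeta_integrand x nu t u.
Proof.
move=> /andP[u0 ut] fC; rewrite /RL_kernel Normc.normcM normcR ger0_norm ?powR_ge0//.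
by rewrite /rbeta_integrand mulrCA ler_wpM2l ?powR_ge0.
Qed.

Lemma rbeta_integrand_ge0 x s t u : 0 <= rbeta_integrand x s t u.
Proof. by rewrite mulr_ge0// powR_ge0. Qed.

Lemma has_csum_RL_kernel (f : nat -> R -> R[i]) (l : R -> R[i]) t u :
  has_csum (f ^~ u) (l u) -> has_csum (fun m => RL_kernel (f m) t u) (RL_kernel l t u).
Proof. exact: has_csumZ. Qed.

(** [ml_fun a] solves the integral equation with forcing term [u^(a-1)]. *)
Lemma RL_ml_fun a (n : nat) t : 0 < Re a -> 0 < t ->
  cintegrable `]0, t[ (RL_kernel (ml_fun (a + n%:R)) t) /\
  (q / rkgamma_int 1 nu)%:C * cintegral `]0, t[ (RL_kernel (ml_fun (a + n%:R)) t) =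
  ml_fun (a + n%:R) t - cpow t (a + n%:R - 1).
Proof.
move=> a0 t0.
have an0 : 0 < Re (a + n%:R) by rewrite cReD cRe_nat ltr_wpDr.
have mJ : measurable (`]0, t[%classic : set R) by exact: measurable_itv.
have y0 : 0 <= `|q| * t `^ nu by rewrite mulr_ge0 ?powR_ge0.
have cb := @cvg_seriesZ _ _ (t ^+ n) _ (cvg_ml_bound a0 y0).
have [| | | | | | |iF sF] := @cintegral_series _ `]0, t[%classic
    (fun m => RL_kernel (ml_term (a + n%:R) m) t)
    (RL_kernel (ml_fun (a + n%:R)) t) (rbeta_integrand (Re a) nu t)
    (fun m => t ^+ n * ((`|q| * t `^ nu) ^+ m * ml_bound (Re a) m)) mJ.
- by move=> m; apply: cintegrable_cmeasurable => //; have [] := RL_ml_term m an0 t0.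
- move=> m u /itv_oo0P hu; apply: normc_RL_kernel_le => //.
  by case/andP: hu => u0 ut; apply: normc_ml_term_le => //; exact: ltW.
- exact: integrable_rbeta.
- by move=> m; rewrite mulr_ge0 ?exprn_ge0 ?(ltW t0)// mulr_ge0 ?exprn_ge0 ?ml_bound_ge0.
- by move=> u _; exact: rbeta_integrand_ge0.
- by apply/cvg_ex; eexists; exact: cb.
- move=> u /itv_oo0P/andP[u0 ut]; apply: has_csum_RL_kernel.
  by have [] := ml_fun_sum n a0 u0 (ltW ut).
split => //.
have [sT _] := ml_fun_sum n a0 t0 (lexx t).
apply: (has_csum_uniq (has_csumZ _ sF)).
have := has_csumS sT; rewrite ml_term0//.
have -> // : (fun m => ml_term (a + n%:R) m.+1 t) =
  (fun m => (q / rkgamma_int 1 nu)%:C *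
     cintegral `]0, t[ (RL_kernel (ml_term (a + n%:R) m) t)).
by apply/funext => m; have [_ ->] := RL_ml_term m an0 t0.
Qed.

(** Superposition of the solutions [ml_fun (a + 2n)]: it solves the equation whose
    forcing term is the sum [J] of the corresponding powers. *)
Lemma RL_ml_series a (D : nat -> R[i]) t : 0 < Re a -> 0 < t ->
  (forall r, 0 < r -> cvgn (series (fun n => normc (D n) * r ^+ (2 * n)))) ->
  let S u := csum (fun n => D n * ml_fun (a + (2 * n)%:R) u) in
  let J u := csum (fun n => D n * cpow u (a + (2 * n)%:R - 1)) in
  [/\ has_csum (fun n => D n * ml_fun (a + (2 * n)%:R) t) (S t),
      has_csum (fun n => D n * cpow t (a + (2 * n)%:R - 1)) (J t),
      cintegrable `]0, t[ (RL_kernel S t) &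
      (q / rkgamma_int 1 nu)%:C * cintegral `]0, t[ (RL_kernel S t) = S t - J t].
Proof.
move=> a0 t0 cD S J.
have mJ : measurable (`]0, t[%classic : set R) by exact: measurable_itv.
have K0 (r : R) : 0 <= ml_total (Re a) r.
  have y0 : 0 <= `|q| * r `^ nu by rewrite mulr_ge0 ?powR_ge0.
  apply: limr_ge; first exact: cvg_ml_bound.
  apply: nearW => n; apply: sumr_ge0 => i _.
  by rewrite mulr_ge0 ?exprn_ge0// ml_bound_ge0.
pose A n := 2 * ml_total (Re a) t * (normc (D n) * t ^+ (2 * n)).
have A0 n : 0 <= A n.
  by rewrite mulr_ge0 ?mulr_ge0 ?normc_ge0 ?exprn_ge0 ?(ltW t0).
have cA : cvgn (series A).
  by apply/cvg_ex; eexists; apply: cvg_seriesZ; exact: (cD t t0).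
have bound n u : 0 < u -> u <= t ->
    normc (D n * ml_fun (a + (2 * n)%:R) u) <= A n * u `^ (Re a - 1).
  move=> u0 ut; rewrite Normc.normcM.
  have [_ h] := ml_fun_sum (2 * n) a0 u0 ut.
  apply: (le_trans (ler_wpM2l (normc_ge0 _) h)).
  rewrite le_eqVlt; apply/orP; left; apply/eqP; rewrite /A; ring.
have sumS u : 0 < u -> u <= t ->
    has_csum (fun n => D n * ml_fun (a + (2 * n)%:R) u) (S u).
  move=> u0 ut.
  have cu := @cvg_seriesZ _ _ (u `^ (Re a - 1)) _ cA.
  have [||l hl _] := @has_csum_le _ (fun n => D n * ml_fun (a + (2 * n)%:R) u)
    (fun n => u `^ (Re a - 1) * A n).
  - by move=> n; rewrite [leRHS]mulrC; exact: bound.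
  - by apply/cvg_ex; eexists; exact: cu.
  - by rewrite /S (has_csum_csum hl).
have sumJ : has_csum (fun n => D n * cpow t (a + (2 * n)%:R - 1)) (J t).
  have ct := @cvg_seriesZ _ _ (t `^ (Re a - 1)) _ (cD t t0).
  have [||l hl _] := @has_csum_le _ (fun n => D n * cpow t (a + (2 * n)%:R - 1))
    (fun n => t `^ (Re a - 1) * (normc (D n) * t ^+ (2 * n))).
  - move=> n; rewrite Normc.normcM normc_cpow//.
    have -> : Re (a + (2 * n)%:R - 1) = Re a - 1 + (2 * n)%:R.
      by rewrite cReB cReD cRe_nat addrAC.
    rewrite powRD; last by rewrite (gt_eqF t0) implybT.
    by rewrite powR_mulrn ?(ltW t0)// mulrCA.
  - by apply/cvg_ex; eexists; exact: ct.
  - by rewrite /J (has_csum_csum hl).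
have iF n := RL_ml_fun (2 * n) a0 t0.
have kE n u : RL_kernel (fun u => D n * ml_fun (a + (2 * n)%:R) u) t u =
    D n * RL_kernel (ml_fun (a + (2 * n)%:R)) t u.
  by rewrite /RL_kernel mulrCA.
have iDF n : cintegrable `]0, t[ (RL_kernel (fun u => D n * ml_fun (a + (2 * n)%:R) u) t).
  apply: (eq_cintegrable mJ _ (cintegrableZ (D n) mJ (iF n).1)) => u _.
  by rewrite kE.
have [| | | | | | |iS sS] := @cintegral_series _ `]0, t[%classic
    (fun n => RL_kernel (fun u => D n * ml_fun (a + (2 * n)%:R) u) t)
    (RL_kernel S t) (rbeta_integrand (Re a) nu t) A mJ.
- by move=> n; exact: cintegrable_cmeasurable.
- move=> n u /itv_oo0P hu; apply: normc_RL_kernel_le => //.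
  by case/andP: hu => u0 ut; exact: (bound n u u0 (ltW ut)).
- exact: integrable_rbeta.
- exact: A0.
- by move=> u _; exact: rbeta_integrand_ge0.
- exact: cA.
- move=> u /itv_oo0P/andP[u0 ut].
  apply: (has_csum_RL_kernel (f := fun n u => D n * ml_fun (a + (2 * n)%:R) u)).
  by apply: sumS => //; exact: ltW.
split => //; first exact: sumS.
apply: (has_csum_uniq (has_csumZ _ sS)).
have sd := has_csumD (sumS t t0 (lexx t)) (has_csumZ (-1) sumJ).
rewrite mulN1r in sd.
have -> // : (fun n => (q / rkgamma_int 1 nu)%:C * cintegral `]0, t[
      (RL_kernel (fun u => D n * ml_fun (a + (2 * n)%:R) u) t)) =
  (fun n => D n * ml_fun (a + (2 * n)%:R) t + -1 * (D n * cpow t (a + (2 * n)%:R - 1))).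
apply/funext => n.
rewrite (@eq_cintegral _ _ _ (fun u => D n * RL_kernel (ml_fun (a + (2 * n)%:R)) t u)); last first.
  by move=> u _; exact: kE.
rewrite (cintegralZ (D n) mJ (iF n).1) mulrCA (iF n).2; ring.
Qed.

End MittagLefflerSeries.

(** * Uniqueness for the homogeneous equation *)

Section Uniqueness.
Context {R : realType}.
Notation mu := (@lebesgue_measure R).
Variables (nu : R).
Hypothesis nu0 : 0 < nu.
Implicit Types (T t u s : R).

(** The kernel of the integral operator, damped by [exp (- n s)]. *)
Let B (n : nat) s : R := expR (- (n%:R * s)) * s `^ (nu - 1).

Let measurable_B n (D : set R) : measurable D -> measurable_fun D (B n).
Proof.
move=> mD; apply: (measurable_funS measurableT) => //.
apply: measurable_funM; last exact: measurable_powR.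
by apply: measurableT_comp => //; apply: measurableT_comp => //; exact: measurable_funM.
Qed.

Let B_le n s : 0 < s -> `|B n.+1 s| <= kgamma_weight 1 nu s.
Proof.
move=> s0; rewrite ger0_norm ?mulr_ge0 ?expR_ge0 ?powR_ge0// kgamma_weight1//.
rewrite ler_wpM2r ?powR_ge0// ler_expR lerN2.
by rewrite ler_peMl ?(ltW s0)// ler1n.
Qed.

Let integrable_B n : mu.-integrable `]0, +oo[ (EFin \o B n.+1).
Proof.
have mP : measurable (`]0, +oo[%classic : set R) by [].
apply: (le_integrable (mu:=mu) mP _ _ (integrable_kgamma_weight ltr01 nu0)).
  by apply/measurable_EFinP; exact: measurable_B.
move=> s /pos_itvP s0; rewrite /= lee_fin (le_trans (B_le n s0))//.
exact: ler_norm.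
Qed.

Let cvg_integral_B : (fun n => \int[mu]_(s in `]0, +oo[) B n.+1 s) @ \oo --> 0.
Proof.
have mP : measurable (`]0, +oo[%classic : set R) by [].
have [|||||_ _ c] := @dominated_convergence _ _ _ mu `]0, +oo[%classic mP
  (fun n s => (B n.+1 s)%:E) (cst 0%E) (EFin \o kgamma_weight 1 nu).
- by move=> n; apply/measurable_EFinP; exact: measurable_B.
- exact: measurable_cst.
- apply: aeW => s /pos_itvP s0; apply: cvg_EFin; first exact: nearW.
  rewrite [X in X @ _ --> _](_ : _ = (fun n => expR (- s) * s `^ (nu - 1) * expR (- s) ^+ n)).
    rewrite -[X in _ --> X](mulr0 (expR (- s) * s `^ (nu - 1))).
    apply: cvgM; first exact: cvg_cst.
    by apply: cvg_expr; rewrite ger0_norm ?expR_ge0// expR_lt1 oppr_lt0.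
  apply/funext => n; rewrite /= /B -mulrN expRM_natl exprS; ring.
- exact: (integrable_kgamma_weight ltr01 nu0).
- by apply: aeW => s n /pos_itvP s0; rewrite lee_fin; exact: B_le.
rewrite integral0 in c.
have c' : (fun n => \int[mu]_(s in `]0%R, +oo[) (B n.+1 s)%:E)%E @ \oo --> (0 : R)%:E by exact: c.
exact: (fine_cvg c').
Qed.

Lemma integrable_norm_Re_Im (D : set R) (f : R -> R[i]) : measurable D ->
  cintegrable D f -> mu.-integrable D (EFin \o (fun u => `|Re (f u)| + `|Im (f u)|)).
Proof.
move=> mD [i1 i2].
exact: (integrableD (mu:=mu) mD (integrable_norm (mu:=mu) i1) (integrable_norm (mu:=mu) i2)).
Qed.

(** A solution of the homogeneous equation is locally integrable: on [`]0, T[]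
    the kernel at time [2 T] is bounded away from zero. *)
Lemma cintegrable_of_RL_kernel (M : R -> R[i]) T : 0 < T ->
  cintegrable `]0, 2 * T[ (RL_kernel nu M (2 * T)) -> cintegrable `]0, T[ M.
Proof.
move=> T0 [g1 g2].
have mJ : measurable (`]0, T[%classic : set R) by exact: measurable_itv.
have m2 : measurable (`]0, 2 * T[%classic : set R) by exact: measurable_itv.
have T2 : T <= 2 * T by rewrite ler_peMl ?ler1n// ltW.
have sub : `]0, T[%classic `<=` (`]0, 2 * T[%classic : set R).
  move=> u /itv_oo0P/andP[u0 uT]; rewrite /= in_itv/= u0/=.
  exact: lt_le_trans T2.
have i1 := integrableS (mu:=mu) m2 mJ sub g1.
have i2 := integrableS (mu:=mu) m2 mJ sub g2.
pose C := T `^ (1 - nu) + (2 * T) `^ (1 - nu).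
pose g u := RL_kernel nu M (2 * T) u.
have ih : mu.-integrable `]0, T[ (EFin \o (fun u => C * (`|Re (g u)| + `|Im (g u)|))).
  by apply: integrable_scale => //; exact: integrable_norm_Re_Im.
have mg : cmeasurable `]0, T[ g by apply: cintegrable_cmeasurable.
have mh : measurable_fun (`]0, T[%classic : set R) (fun u => (2 * T - u) `^ (1 - nu)).
  apply: (measurable_funS measurableT) => //.
  by apply: (measurableT_comp (measurable_powR _)); exact: measurable_funB.
apply: (@eq_cintegrable _ _ (fun u => ((2 * T - u) `^ (1 - nu))%:C * g u)) => //.
  move=> u /itv_oo0P/andP[u0 uT]; rewrite /g /RL_kernel mulrA.
  have pos : 0 < 2 * T - u by rewrite subr_gt0 (lt_le_trans uT).
  rewrite -(rmorphM (real_complex R)) -powRD; last by rewrite (gt_eqF pos) implybT.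
  by rewrite (_ : 1 - nu + (nu - 1) = 0) ?powRr0 ?mul1r//; ring.
apply: (le_cintegrable mJ _ _ ih).
  by apply: cmeasurableM mg; exact: cmeasurable_real.
move=> u /itv_oo0P/andP[u0 uT].
rewrite Normc.normcM normcR ger0_norm ?powR_ge0//.
have uT2 : T <= 2 * T - u by rewrite lerBrDr mulr_natl mulr2n lerD2l ltW.
have u2T : 2 * T - u <= 2 * T by rewrite gerBl ltW.
apply: ler_pM; [exact: powR_ge0|exact: normc_ge0| |exact: normc_le].
rewrite /C; have [nu1|nu1] := leP 0 (1 - nu).
  rewrite -[leLHS]add0r lerD ?powR_ge0// ge0_ler_powR ?nnegrE//.
    by rewrite (le_trans _ uT2)// ltW.
  by rewrite mulr_ge0// ltW.
rewrite -[leLHS]addr0 lerD ?powR_ge0//.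
rewrite -[1 - nu]opprK !(powRN _ (- (1 - nu))) lef_pV2 ?posrE ?powR_gt0//.
  rewrite ge0_ler_powR ?nnegrE ?oppr_ge0 ?(ltW nu1) ?(ltW T0)//.
  by rewrite (le_trans _ uT2)// ltW.
by rewrite (lt_le_trans _ uT2).
Qed.

(** The homogeneous equation only has the zero solution: in the norm
    [\int_0^T (|Re (M u)| + |Im (M u)|) exp (- n u) du] the integral operator is a
    contraction for large [n]. *)
Lemma RL_homogeneous_eq0 (w : R[i]) (M : R -> R[i]) :
  (forall t, 0 < t -> cintegrable `]0, t[ (RL_kernel nu M t)) ->
  (forall t, 0 < t -> M t = w * cintegral `]0, t[ (RL_kernel nu M t)) ->
  forall t, 0 < t -> M t = 0.
Proof.
move=> iM eM t0 t00.
pose T := 2 * t0.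
have T0 : 0 < T by rewrite mulr_gt0.
have t0T : t0 < T by rewrite ltr_pMl// ltr1n.
have mP : measurable (`]0, +oo[%classic : set R) by [].
have mJ (r : R) : measurable (`]0, r[%classic : set R) by exact: measurable_itv.
pose m (u : R) : R := `|Re (M u)| + `|Im (M u)|.
have m_ge0 u : 0 <= m u by rewrite addr_ge0.
have im : mu.-integrable `]0, T[ (EFin \o m).
  apply: (integrable_norm_Re_Im (mJ T)).
  exact: (cintegrable_of_RL_kernel T0 (iM _ (mulr_gt0 (ltr0Sn _ 1) T0))).
pose c0 : R := `|Re w| + `|Im w|.
have c00 : 0 <= c0 by rewrite addr_ge0.
have [n hn] : exists n, c0 * \int[mu]_(s in `]0, +oo[) B n.+1 s <= 1 / 2.
  have cc : (fun n => c0 * \int[mu]_(s in `]0, +oo[) B n.+1 s) @ \oo --> c0 * 0.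
    by apply: cvgM; [exact: cvg_cst|exact: cvg_integral_B].
  rewrite mulr0 in cc.
  have /cvgrPdist_le /(_ (1 / 2)) := cc.
  have h2 : 0 < 1 / 2 :> R by rewrite divr_gt0.
  move=> /(_ h2) [n _ hn]; exists n.
  have := hn n (leqnn n); rewrite sub0r normrN => /(le_trans (ler_norm _)).
  by [].
(* [A] is the damped modulus on the interval from 0 to [T]; cutting off at [T]
   makes it integrable whatever the growth of [M]. *)
pose mT : R -> R := m \_ `]0, T[%classic.
pose A u := mT u * expR (- (n.+1%:R * u)).
have mT_ge0 u : 0 <= mT u by rewrite /mT patchE; case: ifP.
have A_ge0 u : 0 <= A u by rewrite mulr_ge0 ?expR_ge0.
have imT : mu.-integrable `]0, +oo[ (EFin \o mT).
  have i := integrable_restrictT (mJ T) im.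
  exact: (integrableS (mu:=mu) measurableT mP (@subsetT _ _) i).
have mmT : measurable_fun (`]0, +oo[%classic : set R) mT.
  by apply/measurable_EFinP; case/integrableP: imT.
have iA : mu.-integrable `]0, +oo[ (EFin \o A).
  apply: (le_integrable (mu:=mu) mP _ _ imT).
    apply/measurable_EFinP; apply: measurable_funM => //.
    apply: (measurable_funS measurableT) => //.
    by apply: measurableT_comp => //; apply: measurableT_comp => //; exact: measurable_funM.
  move=> u /pos_itvP u0; rewrite /= lee_fin !ger0_norm//.
  by rewrite ler_piMr// expR_le1 oppr_le0 mulr_ge0// ltW.
have [conv iX _] := convolution_half_line iA (integrable_B n).
pose X t := (\int[mu]_(u in `]0%R, t[) (A u * B n.+1 (t - u))%:E)%E.
have X_ge0 t : (0 <= X t)%E.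
  apply: integral_ge0 => u /itv_oo0P/andP[u0 ut]; rewrite lee_fin mulr_ge0//.
  by rewrite mulr_ge0 ?expR_ge0 ?powR_ge0.
(* The homogeneous equation, in absolute value and damped by [exp (- n.+1 t)]. *)
have key t : 0 < t -> t < T -> ((A t)%:E <= c0%:E * X t)%E.
  move=> tp tT.
  have [i1 i2] := iM t tp.
  have E u : 0 < u < t -> A u * B n.+1 (t - u) = expR (- (n.+1%:R * t)) *
      (`|Re (RL_kernel nu M t u)| + `|Im (RL_kernel nu M t u)|).
    move=> /andP[u0 ut]; rewrite /A /mT patchE mem_set; last first.
      by rewrite /= in_itv/= u0 (lt_trans ut).
    rewrite /B /m /RL_kernel cReMr cImMr !normrM (ger0_norm (powR_ge0 _ _)).
    have -> : expR (- (n.+1%:R * t)) =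
        expR (- (n.+1%:R * u)) * expR (- (n.+1%:R * (t - u))).
      by rewrite -expRD; congr expR; ring.
    ring.
  have ik : mu.-integrable `]0, t[ (EFin \o (fun u =>
      `|Re (RL_kernel nu M t u)| + `|Im (RL_kernel nu M t u)|)).
    exact: integrable_norm_Re_Im (mJ t) (iM t tp).
  have XE : X t = (expR (- (n.+1%:R * t)) *
      \int[mu]_(u in `]0, t[) (`|Re (RL_kernel nu M t u)| + `|Im (RL_kernel nu M t u)|))%:E.
    rewrite -(Rintegral_scale _ (mJ t) ik) /Rintegral fineK; last first.
      exact: (integrable_fin_num (mu:=mu) (mJ t) (integrable_scale _ (mJ t) ik)).
    by apply: eq_integral => u /set_mem/itv_oo0P hu; rewrite E.
  rewrite XE -EFinM lee_fin /A mulrC [leRHS]mulrCA ler_wpM2l ?expR_ge0//.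
  rewrite /mT patchE mem_set; last by rewrite /= in_itv/= tp.
  pose I := cintegral `]0, t[ (RL_kernel nu M t).
  have hI : `|Re I| + `|Im I| <=
      \int[mu]_(u in `]0, t[) (`|Re (RL_kernel nu M t u)| + `|Im (RL_kernel nu M t u)|).
    rewrite (RintegralD (mu:=mu) (mJ t) (integrable_norm i1) (integrable_norm i2)).
    by apply: lerD; exact: (le_normr_Rintegral (mu:=mu) (mJ t)).
  apply: (@le_trans _ _ (c0 * (`|Re I| + `|Im I|))); last by rewrite ler_wpM2l.
  rewrite /m (eM t tp) -/I cReM cImM /c0.
  apply: (@le_trans _ _ ((`|Re w| * `|Re I| + `|Im w| * `|Im I|) +
                         (`|Re w| * `|Im I| + `|Im w| * `|Re I|))).
    apply: lerD.
      by apply: (le_trans (ler_normB _ _)); rewrite !normrM.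
    by apply: (le_trans (ler_normD _ _)); rewrite !normrM.
  by rewrite le_eqVlt; apply/orP; left; apply/eqP; ring.
have key' t : 0 < t -> ((A t)%:E <= c0%:E * X t)%E.
  move=> tp; have [tT|Tt] := ltP t T; first exact: key.
  have -> : A t = 0.
    rewrite /A /mT patchE memNset ?mul0r//= in_itv/= => /andP[_].
    by rewrite ltNge Tt.
  by rewrite mule_ge0.
pose I := \int[mu]_(u in `]0, +oo[) A u.
have I0 : 0 <= I by apply: Rintegral_ge0.
have IE : (\int[mu]_(u in `]0%R, +oo[) (A u)%:E = I%:E)%E.
  by rewrite /I /Rintegral fineK//; exact: (integrable_fin_num (mu:=mu) mP iA).
have I_eq0 : I = 0.
  have h : (I%:E <= c0%:E * (I * \int[mu]_(s in `]0%R, +oo[) B n.+1 s)%R%:E)%E.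
    rewrite -IE -conv -(integralZl (mu:=mu) mP iX).
    apply: (le_integral (mu:=mu) mP iA (integrableZl (mu:=mu) mP c0 iX)).
    by move=> t /set_mem/pos_itvP; exact: key'.
  move: h; rewrite -EFinM lee_fin mulrCA => h.
  have : I * (c0 * \int[mu]_(s in `]0, +oo[) B n.+1 s) <= I * (1 / 2).
    by rewrite ler_wpM2l.
  lra.
have Aae : ae_eq mu (`]0, +oo[%classic : set R) (EFin \o A) (cst 0%E).
  apply/(ae_eq_integral_abs mu mP).
    by case/integrableP: iA.
  transitivity (I%:E); last by rewrite I_eq0.
  by rewrite -IE; apply: eq_integral => u _ /=; rewrite ger0_norm.
have X0 : X t0 = 0%E.
  rewrite /X -(integral0 mu (`]0%R, t0[%classic : set R)).
  have mA : measurable_fun (`]0, t0[%classic : set R) A.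
    apply: (@measurable_funS _ _ _ _ (`]0, +oo[%classic : set R)) => //.
      by move=> u /itv_oo0P/andP[u0 _]; rewrite /= in_itv/= u0.
    by apply/measurable_EFinP; case/integrableP: iA.
  apply: (ae_eq_integral (mu:=mu)) => //.
  - apply/measurable_EFinP; apply: measurable_funM => //.
    apply: (measurable_funS measurableT) => //.
    by apply: (measurableT_comp (measurable_B n.+1 measurableT)); exact: measurable_funB.
  - apply: filterS Aae => u hu /itv_oo0P/andP[u0 _] /=.
    have uP : (`]0, +oo[%classic : set R) u by rewrite /= in_itv/= u0.
    have Au : (A u)%:E = 0%:E := hu uP.
    by rewrite (EFin_inj Au) mul0r.
have := key t0 t00 t0T; rewrite X0 mule0 lee_fin => At0.
have : m t0 <= 0.
  move: At0; rewrite /A pmulr_lle0 ?expR_gt0// /mT patchE mem_set//=.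
  by rewrite in_itv/= t00.
rewrite /m => mle; apply: complexP => /=; apply/eqP; rewrite -normr_le0.
  by apply: le_trans mle; rewrite lerDl.
by apply: le_trans mle; rewrite lerDr.
Qed.

End Uniqueness.

(** * The k-Bessel series and the kinetic equation *)

Section KineticTerms.
Context {R : realType}.
Variables (e k nu : R) (b c g lambda mu : R[i]).
Hypotheses (k0 : 0 < k) (nu0 : 0 < nu) (lambda0 : 0 < Re lambda) (mu1 : -1 < Re mu).
Implicit Types (t u : R).

Let q : R := - e `^ nu.

Let Re_mu1_gt0 : 0 < Re (mu + 1).
Proof. by rewrite cReD /= -ltrBlDr sub0r. Qed.

Let Re_mun_gt0 n : 0 < Re (mu + 1 + n%:R).
Proof. by rewrite cReD cRe_nat ltr_wpDr. Qed.

(** The coefficient of [t^(mu+2n)] in the k-Bessel series; it absorbs the factor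
    [2^-(mu+2n)]. *)
Definition bessel_coef (n : nat) : R[i] :=
  c ^+ n * kPoch k g n / kGamma k (lambda * n%:R + mu + (b + 1) / 2%:R)
  / (n`!)%:R ^+ 2 * cpow (2%:R^-1) (mu + (2 * n)%:R).

Lemma normc_kPoch_le_fact (n : nat) :
  normc (kPoch k g n) <= n`!%:R * (normc g + k) ^+ n.
Proof.
rewrite /kPoch; elim: n => [|n IHn].
  by rewrite big_ord0 Normc.normc1 expr0 mulr1.
rewrite big_ord_recr /= Normc.normcM factS natrM exprSr.
rewrite [leRHS](_ : _ = n`!%:R * (normc g + k) ^+ n * (n.+1%:R * (normc g + k)));
  last by ring.
apply: ler_pM; [exact: normc_ge0|exact: normc_ge0|exact: IHn|].
have nk : 0 <= n%:R * k by rewrite mulr_ge0// ltW.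
have h1 : normc (g + (n%:R * k)%:C) <= normc g + n%:R * k.
  by apply: (le_trans (le_normcD _ _)); rewrite normcR ger0_norm.
apply: (le_trans h1); rewrite mulrDr; apply: lerD.
  by rewrite ler_peMl ?normc_ge0// ler1n.
by rewrite ler_pM2r// ler_nat.
Qed.

(** The factorial left in the denominator makes the coefficients summable against
    every geometric sequence. *)
Lemma cvg_bessel_coef t : 0 < t ->
  cvgn (series (fun n => normc (bessel_coef n) * t ^+ (2 * n))).
Proof.
move=> t0.
have [A [B [A0 B0 hAB]]] := normc_inv_kGamma_le (mu + (b + 1) / 2%:R) k0 lambda0.
pose G := normc g + k.
have G0 : 0 <= G by rewrite addr_ge0 ?normc_ge0// ltW.
pose Y := normc c * G * B * (2^-1 * t) ^+ 2.
have Y0 : 0 <= Y.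
  by apply: mulr_ge0; [rewrite !mulr_ge0 ?normc_ge0|rewrite sqr_ge0].
pose K := A * 2^-1 `^ Re mu.
have K0 : 0 <= K by rewrite mulr_ge0 ?powR_ge0.
apply: (@series_le_cvg _ _ (fun n => K * exp_coeff Y n)).
- by move=> n; rewrite mulr_ge0 ?normc_ge0// exprn_ge0// ltW.
- by move=> n; rewrite mulr_ge0// /exp_coeff /= divr_ge0// exprn_ge0.
- move=> n; rewrite /bessel_coef /exp_coeff /=.
  rewrite Normc.normcM normc_cpow ?invr_gt0//.
  have -> : Re (mu + (2 * n)%:R) = Re mu + (2 * n)%:R by rewrite cReD cRe_nat.
  rewrite powRD; last by rewrite invr_eq0 pnatr_eq0 implybT.
  rewrite powR_mulrn ?invr_ge0// !Normc.normcM !Normc.normcV !normcX normc_nat.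
  have h1 := normc_kPoch_le_fact n.
  have h2 := hAB n; rewrite addrA Normc.normcV in h2.
  set P := normc (kPoch k g n) in h1 *.
  set V := (normc (kGamma _ _))^-1 in h2 *.
  have V0 : 0 <= V by rewrite invr_ge0 normc_ge0.
  have f0 : 0 < n`!%:R :> R by rewrite ltr0n fact_gt0.
  have h3 : P * V <= n`!%:R * G ^+ n * (A * B ^+ n).
    by apply: ler_pM => //; exact: normc_ge0.
  pose Z := normc c ^+ n * (n`!%:R ^+ 2)^-1 * (2^-1 `^ Re mu * (2^-1) ^+ (2 * n)) * t ^+ (2 * n).
  have Z0 : 0 <= Z.
    rewrite /Z !mulr_ge0 ?powR_ge0 ?invr_ge0 ?exprn_ge0 ?normc_ge0//.
    exact: ltW.
  rewrite [leLHS](_ : _ = P * V * Z); last by rewrite /Z; ring.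
  apply: (le_trans (ler_wpM2r Z0 h3)).
  rewrite le_eqVlt; apply/orP; left; apply/eqP.
  have -> : Y ^+ n = normc c ^+ n * G ^+ n * B ^+ n * (2^-1 ^+ (2 * n) * t ^+ (2 * n)).
    by rewrite /Y exprMn (exprMn n (_ * G)) (exprMn n (normc c)) -(exprM _ 2 n) (exprMn (2 * n)).
  rewrite /Z /K.
  field.
  by rewrite (gt_eqF f0).
- have h := is_cvg_series_exp_coeff Y.
  by apply/cvg_ex; eexists; apply: cvg_seriesZ; exact: h.
Qed.

Lemma kBessel_termE t n : 0 < t ->
  kBessel_term b k mu c g lambda t n =
  bessel_coef n * cpow t (mu + 1 + (2 * n)%:R - 1).
Proof.
move=> t0; rewrite /kBessel_term /bessel_coef cpowM ?invr_gt0//.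
have -> : mu + 1 + (2 * n)%:R - 1 = mu + (2 * n)%:R by ring.
ring.
Qed.

(** The Gamma factor and the power of [t] turn the Mittag-Leffler function into the
    Neumann series. *)
Lemma kinetic_solution_termE t n : 0 < t ->
  kinetic_solution_term e k nu b c g lambda mu t n =
  bessel_coef n * ml_fun q nu (mu + 1 + (2 * n)%:R) t.
Proof.
move=> t0.
set a := mu + 1 + (2 * n)%:R.
have a0 : 0 < Re a by exact: Re_mun_gt0.
have [hs _] := ml_fun_sum q nu0 (2 * n) Re_mu1_gt0 t0 (lexx t).
rewrite -/a in hs.
have ga := kgamma_int_neq0 ltr01 a0.
have aE : mu + (2 * n)%:R + 1 = a by rewrite /a; ring.
have aE' : a - 1 = mu + (2 * n)%:R by rewrite /a; ring.
have pa := cpow_neq0 (mu + (2 * n)%:R) t0.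
have ML : MittagLeffler nu%:C ((2 * n)%:R + mu + 1) (- (e `^ nu * t `^ nu)%:C) =
    (kgamma_int 1 a * cpow t (mu + (2 * n)%:R))^-1 * ml_fun q nu a t.
  apply: has_csum_csum.
  have := has_csumZ ((kgamma_int 1 a * cpow t (mu + (2 * n)%:R))^-1) hs.
  have -> // : (fun m => (kgamma_int 1 a * cpow t (mu + (2 * n)%:R))^-1 *
      ml_term q nu a m t) = (fun m => (- (e `^ nu * t `^ nu)%:C) ^+ m /
      Gamma (nu%:C * m%:R + ((2 * n)%:R + mu + 1))).
  apply/funext => m.
  have -> : nu%:C * m%:R + ((2 * n)%:R + mu + 1) = a + (m%:R * nu)%:C.
    by rewrite /a (rmorphM (real_complex R)) rmorph_nat; ring.
  have am0 : 0 < Re (a + (m%:R * nu)%:C).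
    by rewrite cReD /= ltr_wpDr// mulr_ge0// ltW.
  rewrite GammaE// /ml_term /ml_coef.
  have -> : - (e `^ nu * t `^ nu)%:C = (q * t `^ nu)%:C.
    by rewrite /q mulNr rmorphN.
  have -> : a + (m%:R * nu)%:C - 1 = mu + (2 * n)%:R + (m%:R * nu)%:C.
    by rewrite -aE'; ring.
  have -> : cpow t (mu + (2 * n)%:R + (m%:R * nu)%:C) =
      cpow t (mu + (2 * n)%:R) * ((t `^ nu) ^+ m)%:C.
    by rewrite cpowD cpow_real// [m%:R * nu]mulrC powRrM powR_mulrn ?powR_ge0.
  have -> : (q * t `^ nu)%:C ^+ m = (q ^+ m)%:C * ((t `^ nu) ^+ m)%:C.
    by rewrite -(rmorphXn (real_complex R)) exprMn (rmorphM (real_complex R)).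
  have gm := kgamma_int_neq0 ltr01 am0.
  move: (kgamma_int 1 a) (kgamma_int 1 (a + _)) (cpow t _) ga gm pa => X Z p X0 Z0 p0.
  by field; rewrite X0 Z0 p0.
rewrite /kinetic_solution_term ML aE GammaE// /bessel_coef cpowM ?invr_gt0//.
move: (kgamma_int 1 a) (cpow t _) (cpow 2%:R^-1 _) ga pa => X p r X0 p0.
rewrite (invfM (n`!%:R ^+ 2)).
move: ((n`!)%:R ^+ 2)^-1 (kGamma _ _)^-1 => x y.
by rewrite invfM; field; rewrite X0 p0.
Qed.

End KineticTerms.

Theorem theorem1 (R : realType) (e k nu : R) (b c g lambda mu N0 : R[i])
    (he : 0 < e) (hk : 0 < k) (hnu : 0 < nu)
    (hlambda : 0 < complex.Re lambda) (hmu : -1 < complex.Re mu) :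
  (forall t : R, 0 < t ->
    csummable (kinetic_solution_term e k nu b c g lambda mu t)) /\
  (forall N : R -> R[i],
    (forall t : R, 0 < t ->
      [/\ csummable (kBessel_term b k mu c g lambda t),
          cintegrable `]0, t[ (RL_integrand nu%:C N t)
        & N t - N0 * kBessel b k mu c g lambda t
            = - (e `^ nu)%:C * RL_integral nu%:C N t])
    <->
    (forall t : R, 0 < t ->
      N t = N0 * csum (kinetic_solution_term e k nu b c g lambda mu t))).
Proof.
pose q : R := - e `^ nu.
pose D := bessel_coef k b c g lambda mu.
have a0 : 0 < Re (mu + 1) by rewrite cReD /= -ltrBlDr sub0r.
have cD t : 0 < t -> cvgn (series (fun n => normc (D n) * t ^+ (2 * n))).
  exact: cvg_bessel_coef.
pose S u := csum (fun n => D n * ml_fun q nu (mu + 1 + (2 * n)%:R) u).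
pose J u := csum (fun n => D n * cpow u (mu + 1 + (2 * n)%:R - 1)).
have sol t (t0 : 0 < t) := RL_ml_series q hnu a0 t0 cD.
have kinE t : 0 < t -> kinetic_solution_term e k nu b c g lambda mu t =
    (fun n => D n * ml_fun q nu (mu + 1 + (2 * n)%:R) t).
  by move=> t0; apply/funext => n; rewrite kinetic_solution_termE.
have besE t : 0 < t -> kBessel_term b k mu c g lambda t =
    (fun n => D n * cpow t (mu + 1 + (2 * n)%:R - 1)).
  by move=> t0; apply/funext => n; rewrite kBessel_termE.
have SE t : 0 < t -> csum (kinetic_solution_term e k nu b c g lambda mu t) = S t.
  by move=> t0; rewrite kinE.
have JE t : 0 < t -> kBessel b k mu c g lambda t = J t.
  by move=> t0; rewrite /kBessel besE.
have mJ (t : R) : measurable (`]0, t[%classic : set R) by exact: measurable_itv.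
have kerE (N : R -> R[i]) t u : (`]0, t[%classic : set R) u ->
    RL_integrand nu%:C N t u = RL_kernel nu N t u.
  move=> /itv_oo0P/andP[u0 ut]; rewrite /RL_integrand /RL_kernel.
  by rewrite -[1 : R[i]]/((1 : R)%:C) -(rmorphB (real_complex R)) cpow_real// subr_gt0.
have RLE (N : R -> R[i]) t : - (e `^ nu)%:C * RL_integral nu%:C N t =
    (q / rkgamma_int 1 nu)%:C * cintegral `]0, t[ (RL_kernel nu N t).
  rewrite /RL_integral GammaE// kgamma_int_real (eq_cintegral (kerE N t)) mulrA.
  congr (_ * _); rewrite /q (rmorphM (real_complex R)) fmorphV.
  by rewrite rmorphN.
split.
  move=> t t0; rewrite kinE//.
  by have [h _ _ _] := sol t t0; exact: has_csum_summable h.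
move=> N; split => H.
  (* The difference with the explicit solution solves the homogeneous equation. *)
  pose M u := N u + (- N0) * S u.
  have i1 (t : R) : 0 < t -> cintegrable `]0, t[ (RL_kernel nu N t).
    by move=> t0; have [_ iN _] := H t t0; exact: (eq_cintegrable (mJ t) (kerE N t) iN).
  have i2 (t : R) : 0 < t -> cintegrable `]0, t[ (fun u => (- N0) * RL_kernel nu S t u).
    by move=> t0; have [_ _ iS _] := sol t t0; exact: cintegrableZ.
  have kM t u : RL_kernel nu M t u = RL_kernel nu N t u + (- N0) * RL_kernel nu S t u.
    by rewrite /RL_kernel /M; ring.
  have M0 : forall t, 0 < t -> M t = 0.
    apply: (@RL_homogeneous_eq0 _ nu hnu (q / rkgamma_int 1 nu)%:C).
      move=> t t0; apply: (eq_cintegrable (mJ t) _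
        (cintegrableD (mJ t) (i1 t t0) (i2 t t0))) => u _.
      by rewrite kM.
    move=> t t0.
    rewrite (@eq_cintegral _ _ _ (fun u =>
      RL_kernel nu N t u + (- N0) * RL_kernel nu S t u)) => [|u _]; last exact: kM.
    have [_ _ iS eS] := sol t t0; have [_ _ eN] := H t t0.
    rewrite (cintegralD (mJ t) (i1 t t0) (i2 t t0)) (cintegralZ _ (mJ t) iS) mulrDr mulrCA eS.
    rewrite -RLE -eN JE// /M /S /J; ring.
  move=> t t0; rewrite SE//; apply/eqP.
  by rewrite -subr_eq0 -mulNr; apply/eqP; exact: M0.
move=> t t0; have [hS hJ iS eS] := sol t t0.
have kN u : (`]0, t[%classic : set R) u -> RL_kernel nu N t u = N0 * RL_kernel nu S t u.
  by move=> /itv_oo0P/andP[u0 _]; rewrite /RL_kernel (H u u0) SE//; ring.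
have iN : cintegrable `]0, t[ (RL_kernel nu N t).
  by apply: (eq_cintegrable (mJ t) _ (cintegrableZ N0 (mJ t) iS)) => u /kN.
split.
- by rewrite besE//; exact: has_csum_summable hJ.
- by apply: (eq_cintegrable (mJ t) _ iN) => u ut; rewrite kerE.
- rewrite RLE (eq_cintegral kN) (cintegralZ _ (mJ t) iS) mulrCA eS.
  by rewrite (H t t0) SE// JE// mulrBr.
Qed.
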